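(* Let $\mathbb P$ be a partial order and $\kappa\geq1$, $\gamma\geq2$ cardinals. The $(\mathbb P,\kappa,\gamma)$-hat game is winning if and only if either (1) $\kappa<\gamma$, or (2) $\mathbb P$ contains an infinite strictly increasing sequence, $\gamma$ is infinite, and there is no strongly MInA cardinal in the interval $(\gamma,\kappa]$.
   Context: The $(\mathbb P,\kappa,\gamma)$-hat game: there is one logician for each $p\in\mathbb P$, each wearing a hat with a colour in $\kappa$. For $p\in\mathbb P$ let $U_p=\{q\in\mathbb P\mid p<_{\mathbb P}q\}$. Give $\kappa$ and $[\kappa]^{<\gamma}$ (subsets of $\kappa$ of size $<\gamma$) the discrete topology and $\kappa^{U_p}$ the product topology. A strategy is a family $\langle f_p\mid p\in\mathbb P\rangle$ of continuous functions $f_p\colon\kappa^{U_p}\to[\kappa]^{<\gamma}$ (logician $p$ may look at finitely many hats of logicians $q>_{\mathbb P}p$). It is winning if for every $h\colon\mathbb P\to\kappa$ some $p$ has $h(p)\in f_p(h\restriction U_p)$; the game is winning if a winning strategy exists. For infinite cardinals $\kappa,\gamma$: given a set $\mathcal F$ of functions $f\colon\kappa^{n_f}\to[\kappa]^{<\gamma}$ ($n_f<\omega$), $A\subseteq\kappa$ is mutually $\mathcal F$-independent if for all $\alpha\in A$, $f\in\mathcal F$, $\alpha_1,\dots,\alpha_{n_f}\in A\setminus\{\alpha\}$: $\alpha\notin f(\alpha_1,\dots,\alpha_{n_f})$. $\kappa$ has the $\gamma$-MInA if every countable such $\mathcal F$ admits a countably infinite mutually $\mathcal F$-independent subset of $\kappa$.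 An infinite cardinal $\kappa$ is strongly MInA if it has the $\gamma$-MInA for all infinite cardinals $\gamma<\kappa$.
   Formalization: The partial order P is assumed nonempty: for the empty order there is no logician to guess correctly, so the game is not winning even when κ<γ, and the equivalence as literally stated fails there. *)

(* Defs.v *)
(* The cardinals kappa and gamma are represented by types K and G. *)
From mathcomp Require Import all_boot all_order all_classical.
From mathcomp Require Import topology function_spaces.

Set Implicit Arguments.
Unset Strict Implicit.
Unset Printing Implicit Defensive.

Local Open Scope classical_set_scope.
Local Open Scope card_scope.

Definition card_lt T U (A : set T) (B : set U) : bool :=
  (A #<= B) && (A #!= B).
Notation "A '#<' B" := (card_lt A B)
  (at level 79, format "A  '#<'  B") : card_scope.

(* [kappa]^{<gamma}, for kappa = |K| and gamma = |G| *)
Definition small_set (K G : Type) : Type := {A : set K | A #< [set: G]}.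

(* [{classic T}] only supplies the choiceType structure required by
   [discrete_topology]; its carrier is [T]. *)
Notation discr T := (discrete_topology {classic T}).

Section HatGame.
Context {d : Order.disp_t} (P : porderType d) (K G : Type).

Definition above (p : P) : Type := {q : P | (p < q)%O}.

Definition guess_family : Type :=
  forall p : P, {ptws above p -> discr K} -> discr (small_set K G).

Definition strategy (f : guess_family) : Prop := forall p, continuous (f p).

Definition restrict_above (h : P -> K) (p : P) : {ptws above p -> discr K} :=
  fun q => h (sval q).
Arguments restrict_above : clear implicits.

Definition winning (f : guess_family) : Prop :=
  forall h : P -> K, exists p : P, sval (f p (restrict_above h p)) (h p).

Definition hat_game_winning : Prop :=
  exists f : guess_family, strategy f /\ winning f.

End HatGame.

(* Functions kappa^n -> [kappa]^{<gamma}, the arity n being part of the data. *)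
Definition fin_ary_fun (K G : Type) : Type :=
  {n : nat & ('I_n -> K) -> small_set K G}.

Definition mutually_independent (K G : Type) (F : set (fin_ary_fun K G))
    (A : set K) : Prop :=
  forall a, A a -> forall f, F f ->
  forall x : 'I_(tag f) -> K, (forall i, (A `\ a) (x i)) ->
  ~ sval (tagged f x) a.

Definition MInA (K G : Type) : Prop :=
  forall F : set (fin_ary_fun K G), countable F ->
  exists2 A : set K, A #= [set: nat] & mutually_independent F A.

Definition strongly_MInA (K : Type) : Prop :=
  infinite_set [set: K] /\
  forall G : Type, infinite_set [set: G] -> [set: G] #< [set: K] -> MInA K G.

(* Main.v *)
(* Along an increasing sequence of the order, let every logician use the same
   rule, a locally finite map from sequences of colours to sets of colours.  Such
   rules compose: from one for colours [X] with guesses of size at most [Y], and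
   one for colours [Y] with guesses of size less than [G], played on the indices
   inside the guesses of the first, one gets a rule for colours [X] with guesses
   of size less than [G].  If [X] lacks the MInA for [Y], witnessed by [F], then
   every sequence in [X] has an entry in the closure of the later ones under
   operations built from [F], for otherwise a lexicographically least exception
   would be mutually independent; guessing closures then wins with guesses of
   size at most [Y].  Induction on the cardinal of [X] reaches [K].

   Conversely, a losing colouring is built by Zorn's lemma from partial
   colourings that already decide that all their points guess wrongly.  One more
   point can be added if it is maximal among the uncoloured ones.  If [M] has
   the MInA, the points queried from one uncoloured point onwards form a
   countable set that can be coloured along a mutually independent sequence.
   For finite [G] compactness suffices. *)
Require Import Defs.
From mathcomp Require Import all_boot all_order.
From mathcomp Require Import all_classical.
From mathcomp Require Import topology function_spaces.
From mathcomp Require Import wochoice.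
From mathcomp Require Import zify.

Local Open Scope classical_set_scope.
Local Open Scope card_scope.

Set Implicit Arguments.
Unset Strict Implicit.
Unset Printing Implicit Defensive.

(** * Cardinals and well-orders *)

Definition embeds (T U : Type) : Prop := exists f : T -> U, injective f.

Lemma embeds_trans (T U V : Type) : embeds T U -> embeds U V -> embeds T V.
Proof. by move=> [f fI] [g gI]; exists (g \o f); exact: inj_comp. Qed.

Lemma embedsP (T U : Type) : embeds T U <-> [set: T] #<= [set: U].
Proof.
split=> [[f fI]|].
  have /injfunPex[g] : exists2 f : T -> U, set_fun [set: T] [set: U] f & set_inj [set: T] f.
    by exists f => // x y _ _ /fI.
  exact: inj_card_le.
move=> /card_leP/injfunPex[f _ fI].
have inT V (v : V) : v \in [set: V] by rewrite in_setT.
exists (fun t => val (f (SigSub (inT T t)))) => x y /val_inj.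
move/fI => /(_ _ _)/(congr1 val) /=; apply; exact: in_setT.
Qed.

(** [u] is the value taken off [A], so that an injection of [A] into [B] can be handled as a total
    function on [T]. *)
Lemma card_le_funP (T U : Type) (A : set T) (B : set U) (u : U) :
  A #<= B <-> exists f : T -> U, (forall a, A a -> B (f a)) /\
    forall a b, A a -> A b -> f a = f b -> a = b.
Proof.
split=> [|[f [fB fI]]].
  rewrite -(card_le_eql (card_setT A)) -(card_le_eqr (card_setT B)).
  move=> /embedsP[f fI].
  exists (fun t => if pselect (t \in A) is left p then val (f (SigSub p)) else u).
  split=> [a|x y] /mem_set Aa; first by case: pselect => // p; exact: set_valP.
  move=> /mem_set Ay /=; case: pselect => [p|]; last by case.
  by case: pselect => [q /val_inj/fI/(congr1 val)|].
have /injfunPex[g] : exists2 f : T -> U, set_fun A B f & set_inj A f.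
  by exists f => // x y /set_mem Ax /set_mem Ay; exact: fI.
exact: inj_card_le.
Qed.

Lemma card_ltNge (T U : Type) (A : set T) (B : set U) : A #< B -> ~ (B #<= A).
Proof.
move=> /andP[AB /negP nAB] BA; apply: nAB.
by rewrite card_eq_le AB BA.
Qed.

(* A maximal set of choice functions on which every evaluation is injective
   projects onto some factor, by maximality; that factor embeds in the others. *)
Lemma exists_min_card (I : Type) (F : I -> Type) :
  inhabited I -> exists i, forall j, embeds (F i) (F j).
Proof.
move=> [i0].
pose P (Z : set (forall i, F i)) :=
  forall i x y, Z x -> Z y -> x i = y i -> x = y.
have [|Z [ZP Zmax]] := @Zorn_bigcup _ P.
  move=> C CP Ctot i x y [X CX Xx] [Y CY Yy] xy.
  have [XY|YX] := Ctot X Y CX CY.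
    by apply: (CP Y CY i) => //; exact: XY.
  by apply: (CP X CX i) => //; exact: YX.
have [[i onto_i]|/forallNP nonto] :=
    pselect (exists i, forall y, exists2 z, Z z & z i = y).
  exists i => j; have /choice[g gP] : forall y, exists z, Z z /\ z i = y.
    by move=> y; have [z] := onto_i y; exists z.
  exists (fun y => g y j) => x y gxy.
  have [[Zx ex] [Zy ey]] := (gP x, gP y).
  by rewrite -ex -ey (ZP _ _ _ Zx Zy gxy).
have {}nonto i : exists y, forall z, Z z -> z i <> y.
  have /existsNP[y yP] := nonto i; exists y => z Zz zy.
  by apply: yP; exists z.
pose z0 i := projT1 (cid (nonto i)).
have z0P i z : Z z -> z i <> z0 i by exact: (projT2 (cid (nonto i))).
exfalso; apply: (Zmax (Z `|` [set z0])).
  split; first by move=> z Zz; left.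
  by move=> /(_ z0 (or_intror erefl)) Zz0; exact: (z0P i0 _ Zz0).
move=> i x y [Zx|->] [Zy|->] // xy; first exact: ZP xy.
  by have := z0P i _ Zx.
by have := z0P i _ Zy; rewrite xy.
Qed.

Lemma embeds_total (T U : Type) : embeds T U \/ embeds U T.
Proof.
have [] := @exists_min_card bool (fun b => if b then T else U) (inhabits true).
by move=> [] H; [left; exact: (H false)|right; exact: (H true)].
Qed.

Lemma card_le_total (T U : Type) (A : set T) (B : set U) : A #<= B \/ B #<= A.
Proof.
have [/embedsP|/embedsP] := embeds_total A B.
  by rewrite (card_le_eql (card_setT _)) (card_le_eqr (card_setT _)); left.
by rewrite (card_le_eql (card_setT _)) (card_le_eqr (card_setT _)); right.
Qed.

Lemma card_leNgt (T U : Type) (A : set T) (B : set U) : ~ (B #<= A) -> A #< B.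
Proof.
move=> nBA; have [AB|//] := card_le_total A B.
apply/andP; split => //; apply/negP; rewrite card_eq_le => /andP[_]; exact: nBA.
Qed.

(** Among the counterexamples [exists_min_card] provides one of least cardinal. *)
Lemma card_lt_ind (X : Type) (Q : set X -> Prop) :
  (forall A, (forall B : set X, B #< A -> Q B) -> Q A) -> forall A, Q A.
Proof.
move=> IH A; apply: contrapT => nQA.
have [[B nQB] Bmin] := @exists_min_card {B | ~ Q B} (fun B => set_type (sval B))
  (inhabits (exist _ A nQA)).
apply: (nQB); apply: IH => C CB; apply: contrapT => nQC.
have /embedsP := Bmin (exist _ C nQC).
rewrite /= (card_le_eql (card_setT _)) (card_le_eqr (card_setT _)).
exact: card_ltNge.
Qed.

Lemma card_le_lt_trans (T U V : Type) (A : set T) (B : set U) (C : set V) :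
  A #<= B -> B #< C -> A #< C.
Proof.
move=> AB /card_ltNge BC; apply: card_leNgt => CA.
by apply: BC; exact: card_le_trans CA AB.
Qed.

Lemma card_lt_le_trans (T U V : Type) (A : set T) (B : set U) (C : set V) :
  A #< B -> B #<= C -> A #< C.
Proof.
move=> /card_ltNge AB BC; apply: card_leNgt => CA.
by apply: AB; exact: card_le_trans BC CA.
Qed.

Lemma infinite_embeds (T : Type) : infinite_set [set: T] <-> embeds nat T.
Proof. by rewrite embedsP; exact: infiniteP. Qed.


(* Zorn on the graphs of injections [B * B -> B] extending a fixed countable
   one: [B] is the set of [b] such that [(b, b)] is in the domain. *)
Lemma embeds_square (Y : Type) : embeds nat Y -> embeds (Y * Y) Y.
Proof.
move=> [nu nuI].
pose D (g : set (Y * Y * Y)) b := exists c, g (b, b, c).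
pose good (g : set (Y * Y * Y)) :=
  [/\ forall a b, D g a -> D g b -> exists c, g (a, b, c),
      forall a b c, g (a, b, c) -> [/\ D g a, D g b & D g c],
      forall a b c c', g (a, b, c) -> g (a, b, c') -> c = c' &
      forall a b a' b' c, g (a, b, c) -> g (a', b', c) -> (a, b) = (a', b')].
(* The seed codes pairs of natural numbers along [nu]; every domain considered below contains the
   range of [nu], a stock of tags. *)
pose g0 : set (Y * Y * Y) :=
  [set x | exists m n, x = (nu m, nu n, nu (pickle (m, n)))].
have pickI m n m' n' : pickle (m, n) = pickle (m', n') -> (m, n) = (m', n').
  exact: (pcan_inj pickleK).
have D0 n : D g0 (nu n) by exists (nu (pickle (n, n))), n, n.
have good0 : good g0.
  split.
  - move=> a b [_ [m [_ [-> _ _]]]] [_ [n [_ [-> _ _]]]].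
    by exists (nu (pickle (m, n))), m, n.
  - by move=> a b c [m [n [-> -> ->]]]; split; exact: D0.
  - by move=> a b c c' [m [n [-> -> ->]]] [m' [n' [/nuI <- /nuI <- ->]]].
  - move=> a b a' b' c [m [n [-> -> ->]]] [m' [n' [-> ->]]] /nuI /pickI.
    by move=> [-> ->].
(* The seed is joined inside the property so that the empty chain, whose union is empty, is covered
   too. *)
have [|g' [g'P g'max]] := @Zorn_bigcup _ (fun g => good (g `|` g0)).
  move=> C CP Ctot.
  have [[X0 CX0]|C0] := pselect (exists X, C X); last first.
    suff -> : \bigcup_(X in C) X = set0 by rewrite set0U.
    by rewrite -subset0 => x [X CX]; case: C0; exists X.
  have XD X a : C X -> D (X `|` g0) a -> D (\bigcup_(X in C) X `|` g0) a.
    by move=> CX [c [Xc|]]; exists c; [left; exists X|right].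
  have pick2 x y : (\bigcup_(X in C) X `|` g0) x ->
    (\bigcup_(X in C) X `|` g0) y ->
    exists2 X, C X & (X `|` g0) x /\ (X `|` g0) y.
    case=> [[X CX Xx]|x0]; case=> [[Z CZ Zy]|y0].
    - have [XZ|ZX] := Ctot X Z CX CZ.
        by exists Z => //; split; left => //; exact: XZ.
      by exists X => //; split; left => //; exact: ZX.
    - by exists X => //; split; [left|right].
    - by exists Z => //; split; [right|left].
    - by exists X0 => //; split; right.
  split.
  - move=> a b [c ca] [c' c'b]; have [X CX [Xa Xb]] := pick2 _ _ ca c'b.
    have [+ _ _ _] := CP X CX.
    move=> /(_ a b (ex_intro _ c Xa) (ex_intro _ c' Xb))[d [Xd|d0]]; exists d.
      by left; exists X.
    by right.
  - move=> a b c gabc; have [X CX [Xc _]] := pick2 _ _ gabc gabc.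
    have [_ + _ _] := CP X CX.
    by move=> /(_ _ _ _ Xc)[? ? ?]; split; exact: XD CX _.
  - move=> a b c c' gc gc'; have [X CX [Xc Xc']] := pick2 _ _ gc gc'.
    have [_ _ F _] := CP X CX; exact: F Xc Xc'.
  - move=> a b a' b' c gc gc'; have [X CX [Xc Xc']] := pick2 _ _ gc gc'.
    have [_ _ _ F] := CP X CX; exact: F Xc Xc'.
move: g'P; set g := g' `|` g0 => -[gtot grange gfun ginj].
have gmax h : g `<` h -> ~ good h.
  move=> [gh hg] goodh; apply: (g'max h).
    split; first by move=> x g'x; apply: gh; left.
    move=> hg'; apply: hg => x hx; left; exact: hg'.
  by rewrite setUidl// => x x0; apply: gh; right.
pose B := D g.
have Bnu n : B (nu n) by have [c c0] := D0 n; exists c; right.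
have /choice[f fP] : forall ab : Y * Y, exists c, B ab.1 -> B ab.2 -> g (ab, c).
  move=> [a b] /=; have [Ba|nBa] := pselect (B a); last by exists a.
  have [Bb|nBb] := pselect (B b); last by exists a.
  by have [c gc] := gtot _ _ Ba Bb; exists c.
have fB a b : B a -> B b -> B (f (a, b)).
  by move=> Ba Bb; have [] := grange _ _ _ (fP (a, b) Ba Bb).
have fI a b a' b' : B a -> B b -> B a' -> B b' -> f (a, b) = f (a', b') ->
    a = a' /\ b = b'.
  move=> Ba Bb Ba' Bb' e; have := fP (a, b) Ba Bb; rewrite e => g1.
  by have [-> ->] := ginj _ _ _ _ _ g1 (fP (a', b') Ba' Bb').
(* If the complement of [B] embeds in [B], then so does [Y], with the tags [nu 0] and [nu 1]
   separating the two pieces, and the pairing [f] on [B] is pulled back. *)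
have [|] := card_le_total (~` B) B.
  move=> /(card_le_funP _ _ (nu 0))[u [uB uI]].
  pose e y := if pselect (B y) then f (nu 0, y) else f (nu 1, u y).
  have eB y : B (e y).
    rewrite /e; case: pselect => [By|nBy]; first exact: fB _ _ (Bnu _) By.
    exact: fB _ _ (Bnu _) (uB _ nBy).
  have eI : injective e.
    move=> x y; rewrite /e; case: pselect => Bx; case: pselect => By.
    - by move=> /(fI _ _ _ _ (Bnu _) Bx (Bnu _) By)[].
    - by move=> /(fI _ _ _ _ (Bnu _) Bx (Bnu _) (uB _ By))[/nuI].
    - by move=> /(fI _ _ _ _ (Bnu _) (uB _ Bx) (Bnu _) By)[/nuI].
    - by move=> /(fI _ _ _ _ (Bnu _) (uB _ Bx) (Bnu _) (uB _ By))[_]; exact: uI.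
  exists (fun xy => f (e xy.1, e xy.2)) => -[x y] [x' y'] /=.
  by case/fI => // /eI -> /eI ->.
(* Otherwise [v] copies [B] outside itself. Pairs from [B] and its copy, not both in [B], get codes
   in the copy, with [tag s t] recording where the two entries lie; this extends [g] properly. *)
move=> /(card_le_funP _ _ (nu 0))[v [vB vI]]; exfalso.
pose w (s : bool) b := if s then b else v b.
pose tag (s t : bool) := nu (s.*2 + t).
have wI s s' b b' : B b -> B b' -> w s b = w s' b' -> s = s' /\ b = b'.
  move=> Bb Bb'; case: s; case: s' => /= e.
  - by rewrite e.
  - by case: (vB _ Bb'); rewrite -e.
  - by case: (vB _ Bb); rewrite e.
  - by rewrite (vI _ _ Bb Bb' e).
have tagI s s' t t' : tag s t = tag s' t' -> s = s' /\ t = t'.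
  by move/nuI; case: s; case: s'; case: t; case: t'.
pose new : set (Y * Y * Y) := [set x | exists s t a b, [/\ B a, B b, ~~ (s && t) &
  x = (w s a, w t b, v (f (f (tag s t, a), b)))]].
have Bw s b : B b -> B (w s b) -> s by case: s => //= /vB nb /nb.
have fv c : B c -> ~ B (v c) by exact: vB.
have Bf s t a b : B a -> B b -> B (f (f (tag s t, a), b)).
  by move=> Ba Bb; apply: (fB) => //; apply: (fB) => //; exact: Bnu.
have Dnew s b : B b -> D (g `|` new) (w s b).
  move=> Bb; case: s => /=; first by have [c gc] := Bb; exists c; left.
  by exists (v (f (f (tag false false, b), b))); right; exists false, false, b, b.
have newD b : D (g `|` new) b -> exists s c, B c /\ b = w s c.
  move=> [c [gc|[s [t [x [y [Bx By _ [-> _ _]]]]]]]]; last by exists s, x.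
  by exists true, b; split => //; exists c.
apply: (gmax (g `|` new)).
  split=> [x gx|]; first by left.
  move=> /(_ (v (nu 0), v (nu 0), v (f (f (tag false false, nu 0), nu 0)))) H.
  have [|Bv _ _] := grange _ _ _ (H _).
    by right; exists false, false, (nu 0), (nu 0).
  exact: vB _ (Bnu 0) Bv.
split.
- move=> _ _ /newD[s [a [Ba ->]]] /newD[t [b [Bb ->]]].
  have [st|st] := boolP (s && t).
    move: st => /andP[-> ->] /=; have [c gc] := gtot _ _ Ba Bb.
    by exists c; left.
  by exists (v (f (f (tag s t, a), b))); right; exists s, t, a, b.
- move=> a b c [/grange[Da Db Dc]|[s [t [x [y [Bx By st [-> -> ->]]]]]]].
    by split; [exact: (Dnew true)|exact: (Dnew true)|exact: (Dnew true)].
  split; [exact: Dnew|exact: Dnew|].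
  by apply: (Dnew false); exact: Bf.
- move=> a b c c' [gc|[s [t [x [y [Bx By st [-> -> ->]]]]]]].
    case=> [|[s [t [x [y [Bx By st [ea eb ->]]]]]]]; first exact: gfun gc.
    have [Ba Bb _] := grange _ _ _ gc.
    by move: st; rewrite (Bw s x) -?ea// (Bw t y) -?eb.
  case=> [gc|[s' [t' [x' [y' [Bx' By' st' [ea eb ->]]]]]]].
    have [Ba Bb _] := grange _ _ _ gc.
    by move: st; rewrite (Bw s x)// (Bw t y).
  have [<- <-] := wI _ _ _ _ Bx Bx' ea.
  by have [<- <-] := wI _ _ _ _ By By' eb.
- move=> a b a' b' c [gc|[s [t [x [y [Bx By st [-> -> ->]]]]]]].
    case=> [|[s [t [x [y [Bx By st [_ _ ec]]]]]]]; first exact: ginj gc.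
    have [_ _ Bc] := grange _ _ _ gc.
    by case: (fv (f (f (tag s t, x), y))); [exact: Bf|rewrite -ec].
  case=> [gc|[s' [t' [x' [y' [Bx' By' st' [-> -> ec]]]]]]].
    have [_ _ Bc] := grange _ _ _ gc.
    by case: (fv (f (f (tag s t, x), y))) => //; exact: Bf.
  have := vI _ _ (Bf s t _ _ Bx By) (Bf s' t' _ _ Bx' By') ec.
  have Bt a0 s0 t0 : B a0 -> B (f (tag s0 t0, a0)) by exact: fB _ _ (Bnu _).
  case/(fI _ _ _ _ (Bt _ _ _ Bx) By (Bt _ _ _ Bx') By') => + ->.
  by case/(fI _ _ _ _ (Bnu _) Bx (Bnu _) Bx') => /tagI[-> ->] ->.
Qed.

Lemma embeds_prod (T U Y : Type) : embeds nat Y ->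
  embeds T Y -> embeds U Y -> embeds (T * U) Y.
Proof.
move=> Yinf [f fI] [g gI]; apply: embeds_trans (embeds_square Yinf).
by exists (fun x => (f x.1, g x.2)) => -[x1 x2] [y1 y2] [/fI /= -> /gI ->].
Qed.

Lemma embeds_sum (T U Y : Type) : embeds nat Y ->
  embeds T Y -> embeds U Y -> embeds (T + U) Y.
Proof.
move=> /[dup] [[nu nuI]] Yinf [f fI] [g gI].
apply: embeds_trans (embeds_square Yinf).
exists (fun x => match x with inl t => (nu 0, f t) | inr u => (nu 1, g u) end).
move=> [x|x] [y|y] [].
- by move=> /fI ->.
- by move=> /nuI.
- by move=> /nuI.
- by move=> /gI ->.
Qed.

(** Iterated pairing loses the length of a sequence, which is therefore stored beside it. *)
Lemma embeds_seq (T Y : Type) : embeds nat Y -> embeds T Y -> embeds (seq T) Y.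
Proof.
move=> /[dup] [[nu nuI]] Yinf [f fI].
have [p pI] := embeds_square Yinf.
pose e := foldr (fun t y => p (f t, y)) (nu 0).
exists (fun s => p (nu (size s), e s)) => s s' /pI[/nuI].
elim: s s' => [|t s IH] [|t' s'] //= [/IH {}IH] /pI[/fI -> /IH] ->.
by [].
Qed.

Lemma embeds_gentree (T Y : Type) : embeds nat Y -> embeds T Y ->
  embeds (GenTree.tree T) Y.
Proof.
move=> Yinf TY; have [e eI] := embeds_seq Yinf (embeds_sum Yinf Yinf TY).
exists (e \o @GenTree.encode T); apply: inj_comp => //.
exact: (pcan_inj (@GenTree.codeK T)).
Qed.

Lemma preimage_card_le (T U : Type) (f : T -> U) (B : set U) :
  injective f -> f @^-1` B #<= B.
Proof.
move=> fI; have [[b _]|B0] := pselect (B !=set0).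
  by apply/(card_le_funP _ _ b); exists f; split=> // x y _ _ /fI.
suff -> : f @^-1` B = set0 by exact: card_ge0.
by rewrite -subset0 => x Bx; apply: B0; exists (f x).
Qed.

(** Least elements of singletons and pairs already give reflexivity and totality; antisymmetry then
    yields transitivity. *)
Definition wo_rel (X : Type) (R : X -> X -> Prop) : Prop :=
  (forall A : set X, A !=set0 -> exists z, A z /\ forall y, A y -> R z y) /\
  forall x y, R x y -> R y x -> x = y.

Lemma exists_wo_rel (X : Type) : exists R : X -> X -> Prop, wo_rel R.
Proof.
have [R Rwo] := well_ordering_principle {classic X}.
have Rmin (A : set X) : A !=set0 ->
    exists z, unique (fun z => A z /\ forall y, A y -> R z y) z.
  move=> [x Ax]; have [|z [[Az zmin] zuniq]] := Rwo (mem A).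
    by exists x; exact: mem_set.
  exists z; split.
    by split; [exact: set_mem|move=> y Ay; apply: zmin; exact: mem_set].
  move=> y [Ay ymin]; apply: zuniq; split; first exact: mem_set.
  by move=> t /set_mem; exact: ymin.
exists R; split=> [A /Rmin[z [zP _]]|x y Rxy Ryx]; first by exists z.
have refl z : R z z.
  have [t [[]]] := Rmin [set z] (ex_intro _ z erefl).
  by move=> -> /(_ z erefl).
have [z [_ zuniq]] := Rmin [set x; y] (ex_intro _ x (or_introl erefl)).
transitivity z.
  by rewrite -(zuniq x)//; split; [left|move=> t [->|->]].
by apply: zuniq; split; [right|move=> t [->|->]].
Qed.

Section WoRel.
Context (X : Type) (R : X -> X -> Prop) (Rwo : wo_rel R).

Lemma wo_trans x y z : R x y -> R y z -> R x z.
Proof.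
move=> xy yz.
have [t [tA tmin]] := Rwo.1 [set x; y; z] (ex_intro _ x (or_introl (or_introl erefl))).
have [tx ty tz] : [/\ R t x, R t y & R t z].
  by split; apply: tmin; [left; left|left; right|right].
move: tA => [[]|] tE.
- by rewrite -tE.
- by rewrite (Rwo.2 _ _ xy) // -tE.
- by rewrite -(Rwo.2 _ _ yz) // -tE.
Qed.

End WoRel.

(** An arbitrary well-order is cut at the least [a] whose closed initial segment is as large as [X].
    As [X] is infinite, it still embeds in the points strictly below [a], and the order is pulled
    back along this embedding. *)
Lemma exists_initial_wo (X : Type) : infinite_set [set: X] ->
  exists R : X -> X -> Prop,
    (forall A : set X, A !=set0 -> exists z, A z /\ forall y, A y -> R z y) /\
    forall a, [set b | R b a] #< [set: X].
Proof.
move=> Xinf; have [R Rwo] := exists_wo_rel X.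
pose big := [set a | [set: X] #<= [set b | R b a]].
have [big_n0|big0] := pselect (big !=set0); last first.
  exists R; split=> [|a]; first exact: Rwo.1.
  by apply: card_leNgt => Xa; apply: big0; exists a.
have [a [biga amin]] := Rwo.1 _ big_n0.
pose S' := [set b | ~ R a b].
(* The closed segment below [a] is [S'] with the single point [a] added. *)
have XS : embeds X (S' + unit).
  apply: (@embeds_trans _ (set_type [set b | R b a])).
    by apply/embedsP; rewrite (card_le_eqr (card_setT _)).
  exists (fun b => if pselect (val b \in S') is left p then inl (SigSub p) else inr tt).
  move=> [x /[dup] /set_mem /= xa px] [y /[dup] /set_mem /= ya py] /=.
  case: pselect => [p|np]; case: pselect => [q|nq] //.
    by move=> [xy]; apply: val_inj.
  move=> _; apply: val_inj => /=.
  have eq_a z : R z a -> ~ (z \in S') -> z = a.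
    by move=> za zS; apply: Rwo.2 => //; apply: contrapT => az; apply: zS; exact: mem_set.
  by rewrite (eq_a x)// (eq_a y).
have S'inf : embeds nat S'.
  apply/embedsP/infiniteP => S'fin; apply: Xinf.
  have : finite_set [set: S' + unit].
    have -> : [set: S' + unit] = inl @` setT `|` inr @` setT.
      by apply/seteqP; split=> // -[x|x] _; [left|right]; exists x.
    by rewrite finite_setU; split; apply: finite_image => //; exact: finite_finset.
  by apply: card_le_finite; exact/embedsP.
have [f fI] : embeds X S'.
  apply: embeds_trans XS (embeds_sum S'inf _ _); first by exists id.
  have [nu nuI] := S'inf; by exists (fun=> nu 0) => -[] [].
pose g x := val (f x); have gI : injective g by move=> x y /val_inj/fI.
exists (fun x y => R (g x) (g y)); split=> [A [x Ax]|x].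
  have [_ [[z Az <-] zmin]] := Rwo.1 (g @` A) (ex_intro _ _ (imageP g Ax)).
  by exists z; split=> // y Ay; apply: zmin; exists y.
apply: card_le_lt_trans (preimage_card_le [set b | R b (g x)] gI) _.
apply: card_leNgt => bigx.
by have : S' (g x) := set_valP (f x); apply; exact: amin.
Qed.

(** * Uniform strategies *)

Section Locality.
Context {X : Type}.
Implicit Types x y : nat -> X.

Definition agree (N : nat) x y : Prop := forall i, (i < N)%N -> y i = x i.

Definition tail (n : nat) x : nat -> X := fun i => x (n + i)%N.

(** This is continuity into a discrete space, for the product topology on sequences of discrete
    colours. *)
Definition locally_finite (T : Type) (f : (nat -> X) -> T) : Prop :=
  forall x, exists N, forall y, agree N x y -> f y = f x.

Lemma agreeW M N x y : (M <= N)%N -> agree N x y -> agree M x y.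
Proof. by move=> MN xy i iM; apply: xy; exact: leq_trans MN. Qed.

Lemma agree_tail M n x y : agree (n + M) x y -> agree M (tail n x) (tail n y).
Proof. by move=> xy i iM; apply: xy; rewrite ltn_add2l. Qed.

Lemma tail_tail m n x : tail n (tail m x) = tail (m + n) x.
Proof. by apply/funext => i; rewrite /tail addnA. Qed.

Lemma locally_finite_bounded (T : Type) (f : nat -> (nat -> X) -> T) :
  (forall n, locally_finite (f n)) -> forall x M, exists N, forall y,
    agree N x y -> forall n, (n < M)%N -> f n y = f n x.
Proof.
move=> flf x; elim=> [|M [N NP]]; first by exists 0.
have [N' N'P] := flf M x; exists (maxn N N') => y xy n.
rewrite ltnS leq_eqVlt => /predU1P[->|nM].
  by apply: N'P; apply: agreeW xy; exact: leq_maxr.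
by apply: NP => //; apply: agreeW xy; exact: leq_maxl.
Qed.

End Locality.

Lemma locally_finite_comp (X Y T : Type) (F : (nat -> X) -> nat -> Y)
    (f : (nat -> Y) -> T) :
  (forall n, locally_finite (F^~ n)) -> locally_finite f ->
  locally_finite (f \o F).
Proof.
move=> Flf flf x; have [M MP] := flf (F x).
have [N NP] := locally_finite_bounded Flf x M.
by exists N => y /NP xy; apply: MP.
Qed.

(** The rule does not depend on the position, so that it can be restarted in any tail; composition
    of rules relies on this. *)
Definition uniform_win (X : Type) (small : set (set X)) : Prop :=
  exists Phi : (nat -> X) -> set X, [/\ locally_finite Phi,
    forall x, small (Phi x) &
    forall h : nat -> X, exists n, Phi (tail n.+1 h) (h n)].

Notation uniform_win_lt X G := (uniform_win [set A : set X | A #< [set: G]]).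
Notation uniform_win_le X G := (uniform_win [set A : set X | A #<= [set: G]]).

Lemma uniform_win_embeds (X X' G : Type) : embeds X' X ->
  uniform_win_lt X G -> uniform_win_lt X' G.
Proof.
move=> [f fI] [Phi [Plf Psmall Pwin]].
exists (fun x => f @^-1` Phi (f \o x)); split=> [x|x|h].
- have [N NP] := Plf (f \o x); exists N => y xy.
  by rewrite (NP (f \o y))// => i iN /=; rewrite xy.
- apply: card_le_lt_trans (Psmall (f \o x)); exact: preimage_card_le.
- by have [n] := Pwin (f \o h); exists n.
Qed.

(** Guess all colours up to the next one in an initial well-order: this is right wherever the colour
    is least in the whole sequence. *)
Lemma uniform_win_self (X : Type) : infinite_set [set: X] -> uniform_win_lt X X.
Proof.
move=> /exists_initial_wo[R [Rmin Rsmall]].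
exists (fun x => [set b | R b (x 0)]); split=> [x|x|h].
- by exists 1 => y xy; rewrite xy.
- exact: Rsmall.
have [_ [[n _ <-] nmin]] := Rmin (range h) (ex_intro _ (h 0) (imageT h 0)).
by exists n; apply: nmin; exact: imageT.
Qed.

(** The least index is determined by the truth values up to it, and finitely many of these need only
    a finite prefix. *)
Lemma locally_finite_ex_minn (X : Type) (Q : nat -> (nat -> X) -> bool)
    (Qex : forall x, exists n, Q n x) :
  (forall n, locally_finite (Q n)) -> locally_finite (fun x => ex_minn (Qex x)).
Proof.
move=> Qlf x; have [N NP] := locally_finite_bounded Qlf x (ex_minn (Qex x)).+1.
exists N => y /NP QE; case: ex_minnP QE => n Qn nmin QE; case: ex_minnP => m Qm mmin.
have mn : (m <= n)%N by apply: mmin; rewrite QE.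
by apply/eqP; rewrite eqn_leq mn nmin// -QE.
Qed.

(* Positions where [Phi] is right recur in every tail; at such a position the
   colour is replaced by its index, in [Y], inside the guess of [Phi], and [Psi]
   is played on the sequence of these indices. *)
Lemma uniform_win_comp (X Y G : Type) : inhabited Y ->
  uniform_win_le X Y -> uniform_win_lt Y G -> uniform_win_lt X G.
Proof.
move=> [y0] [Phi [Phi_lf Phi_small Phi_win]] [Psi [Psi_lf Psi_small Psi_win]].
have /choice[e eI] : forall A : set X, exists f : X -> Y, A #<= [set: Y] ->
    forall a b, A a -> A b -> f a = f b -> a = b.
  move=> A; have [/(card_le_funP _ _ y0)[f [_ fI]]|nA] := boolP (A #<= [set: Y]).
    by exists f.
  by exists (fun=> y0).
pose right n x := `[< Phi (tail n.+1 x) (x n) >].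
have right_ex x : exists n, right n x.
  by have [n nP] := Phi_win x; exists n; exact/asboolP.
have right_lf n : locally_finite (right n).
  move=> x; have [N NP] := Phi_lf (tail n.+1 x); exists (n.+1 + N) => y xy.
  rewrite /right (NP (tail n.+1 y)); last exact: agree_tail.
  by rewrite xy// ltn_addr.
pose nu x := ex_minn (right_ex x).
have nu_lf : locally_finite nu by exact: locally_finite_ex_minn.
have nuP x : Phi (tail (nu x).+1 x) (x (nu x)).
  by rewrite /nu; case: ex_minnP => n /asboolP.
(* [iter k next x] is what follows the first [k] right positions, and [col x k] the index of the
   colour at the right position after them. *)
pose next x := tail (nu x).+1 x.
pose col0 x := e (Phi (next x)) (x (nu x)).
pose col x k := col0 (iter k next x).
have next_lf n : locally_finite (fun x => next x n).
  move=> x; have [N NP] := nu_lf x; exists (maxn N ((nu x).+1 + n.+1)) => y xy.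
  rewrite /next NP; last by apply: agreeW xy; exact: leq_maxl.
  by rewrite /tail xy// (leq_trans _ (leq_maxr _ _))// addnS.
have iter_lf k n : locally_finite (fun x => iter k next x n).
  elim: k n => [|k IH] n; first by move=> x; exists n.+1 => y xy; exact: xy.
  exact: (locally_finite_comp IH (next_lf n)).
have col0_lf : locally_finite col0.
  move=> x; have [N1 N1P] := nu_lf x.
  have [N2 N2P] := locally_finite_comp next_lf Phi_lf x.
  exists (maxn (maxn N1 N2) (nu x).+1) => y xy.
  have N1N2 := leq_maxl (maxn N1 N2) (nu x).+1.
  have := N2P y; rewrite /= /col0 => ->; last first.
    by apply: agreeW xy; apply: leq_trans N1N2; exact: leq_maxr.
  rewrite N1P ?xy ?leq_maxr//.
  by apply: agreeW xy; apply: leq_trans N1N2; exact: leq_maxl.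
have col_lf k : locally_finite (col^~ k).
  exact: (locally_finite_comp (iter_lf k) col0_lf).
exists (fun x => [set z | Phi x z /\ Psi (col x) (e (Phi x) z)]).
split=> [x|x|h].
- have [N1 N1P] := Phi_lf x; have [N2 N2P] := locally_finite_comp col_lf Psi_lf x.
  exists (maxn N1 N2) => y xy; rewrite N1P; last by apply: agreeW xy; exact: leq_maxl.
  by have /= -> := N2P y; last by apply: agreeW xy; exact: leq_maxr.
- apply: card_le_lt_trans (Psi_small (col x)).
  apply/(card_le_funP _ _ y0); exists (e (Phi x)); split=> [z []//|a b [Pa _] [Pb _]].
  by apply: eI => //; exact: Phi_small.
- have [k] := Psi_win (col h).
  have -> : tail k.+1 (col h) = col (iter k.+1 next h).
    by apply/funext => i; rewrite /tail /col addnC iterD.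
  have [m mE] : exists m, iter k next h = tail m h.
    elim: k => [|k [m mE]]; first by exists 0.
    by exists (m + (nu (tail m h)).+1); rewrite iterS mE -tail_tail.
  rewrite /col iterS /col0 mE; set x := tail m h => PsiP.
  exists (m + nu x); rewrite -addnS -tail_tail; split; first exact: nuP.
  exact: PsiP.
Qed.

(** * Closures and independent sequences *)

Section Operations.
Context {X L : Type} (op : L -> seq X -> X).

Inductive op_closure (B : set X) : X -> Prop :=
| op_closure_base x : B x -> op_closure B x
| op_closure_op l xs : (forall x, x \in (xs : seq {classic X}) -> op_closure B x) ->
    op_closure B (op l xs).

Lemma sub_op_closure (B B' : set X) :
  B `<=` op_closure B' -> op_closure B `<=` op_closure B'.
Proof.
by move=> BB' x; elim=> {x} [x /BB'//|l xs _ IH]; exact: op_closure_op.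
Qed.

Lemma op_closure_finitary (h : nat -> X) (P : set nat) x :
  op_closure (h @` P) x ->
  exists N, op_closure (h @` (P `&` [set m | (m < N)%N])) x.
Proof.
elim=> {x} [_ [m Pm <-]|l xs _ IH].
  by exists m.+1; apply: op_closure_base; exists m => //; split=> /=.
suff [N NP] : exists N, forall x, x \in (xs : seq {classic X}) ->
    op_closure (h @` (P `&` [set m | (m < N)%N])) x.
  by exists N; exact: op_closure_op.
have mono M N : (M <= N)%N -> op_closure (h @` (P `&` [set m | (m < M)%N])) `<=`
    op_closure (h @` (P `&` [set m | (m < N)%N])).
  move=> MN; apply: sub_op_closure => _ [m [Pm /= mM] <-].
  by apply: op_closure_base; exists m => //; split=> //=; exact: leq_trans MN.
elim: xs IH => [|x xs IHxs] IH; first by exists 0.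
have [N NP] : exists N, forall x, x \in (xs : seq {classic X}) ->
    op_closure (h @` (P `&` [set m | (m < N)%N])) x.
  by apply: IHxs => y yxs; apply: IH; rewrite in_cons yxs orbT.
have [M MP] := IH x (mem_head _ _).
exists (maxn M N) => y; rewrite in_cons => /predU1P[->|/NP].
  by apply: mono MP; exact: leq_maxl.
by apply: mono; exact: leq_maxr.
Qed.

(** Terms over variables in [nat] and operation symbols in [L] are coded as trees so that they can
    be counted; the symbol is the first child of its node, and malformed trees get the value
    [x 0]. *)
Fixpoint eval_tree (x : nat -> X) (t : GenTree.tree (nat + L)) : X :=
  match t with
  | GenTree.Leaf (inl n) => x n
  | GenTree.Node _ (GenTree.Leaf (inr l) :: ts) => op l (map (eval_tree x) ts)
  | _ => x 0
  end.

(** Every element of the closure is the value of a term, and the terms embed in [Y]. *)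
Lemma op_closure_card_le (Y : Type) (x : nat -> X) (P : set nat) :
  embeds nat Y -> embeds L Y -> op_closure (x @` P) #<= [set: Y].
Proof.
move=> Yinf LY.
have tY : embeds (GenTree.tree (nat + L)) Y.
  exact: embeds_gentree (embeds_sum Yinf Yinf LY).
apply: (card_le_trans (B := range (eval_tree x))); last first.
  by apply: card_le_trans (card_image_le _ _) _; exact/embedsP.
apply: subset_card_le => y; elim=> {y} [_ [m _ <-]|l xs _ IH].
  by exists (GenTree.Leaf (inl m)).
have [ts <-] : exists ts, map (eval_tree x) ts = xs.
  elim: xs IH => [|y ys IHys] IH; first by exists [::].
  have [t _ tE] := IH y (mem_head _ _).
  have [|ts tsE] := IHys; first by move=> z zys; apply: IH; rewrite in_cons zys orbT.
  by exists (t :: ts); rewrite /= tE tsE.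
by exists (GenTree.Node 0 (GenTree.Leaf (inr l) :: ts)).
Qed.

End Operations.

(* The last clause closes under choosing, for [b] in the closure, a tuple
   [xi] with [b] in [f xi] that agrees with [a] off [I] and lies below [b] on [I]. *)
Lemma exists_closure (X Y : Type) (R : X -> X -> Prop)
    (e : nat -> fin_ary_fun X Y) : X -> embeds nat Y ->
  exists cl : set X -> set X,
  [/\ (forall B, B `<=` cl B),
      (forall B B', B `<=` cl B' -> cl B `<=` cl B'),
      (forall (h : nat -> X) P x, cl (h @` P) x ->
         exists N, cl (h @` (P `&` [set m | (m < N)%N])) x),
      (forall (h : nat -> X) P, cl (h @` P) #<= [set: Y]) &
      (forall i (a : 'I_(tag (e i)) -> X) B, (forall j, cl B (a j)) ->
         sval (tagged (e i) a) `<=` cl B) /\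
      (forall i (a : 'I_(tag (e i)) -> X) (I : pred 'I_(tag (e i))) b B,
         (forall j, cl B (a j)) -> cl B b ->
         let good xi := [/\ forall j, ~~ I j -> xi j = a j,
             forall j, I j -> R (xi j) b & sval (tagged (e i) xi) b] in
         (exists xi, good xi) ->
         exists xi, good xi /\ forall j, cl B (xi j))].
Proof.
move=> x0 Yinf; have [nu nuI] := Yinf; pose y0 := nu 0.
have /choice[u uI] : forall A : set X, exists f : X -> Y, A #<= [set: Y] ->
    forall a b, A a -> A b -> f a = f b -> a = b.
  move=> A; have [/(card_le_funP _ _ y0)[f [_ fI]]|nA] := boolP (A #<= [set: Y]).
    by exists f.
  by exists (fun=> y0).
pose eps T (t0 : T) (P : set T) : T := xget (t0 : {classic T}) P.
have epsP T (t0 t : T) (P : set T) : P t -> P (eps T t0 P).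
  by move=> Pt; exact: (xgetPex (t0 : {classic T}) (ex_intro P t Pt)).
pose arg i (xs : seq X) : 'I_(tag (e i)) -> X := fun j => nth x0 xs j.
(* [val_op i y] picks the element of index [y] in a value of [e i], so that the operations for all
   [y] produce the whole value. *)
pose val_op i y xs := eps X x0
  [set z | sval (tagged (e i) (arg i xs)) z /\ u (sval (tagged (e i) (arg i xs))) z = y].
(* The argument list carries [a] in its first entries and [b] at position [tag (e i)]; [choice_op]
   returns one entry of a fixed good tuple. *)
pose good i (J : seq bool) xs (xi : 'I_(tag (e i)) -> X) :=
  let b := nth x0 xs (tag (e i)) in
  [/\ forall j : 'I_(tag (e i)), ~~ nth false J j -> xi j = nth x0 xs j,
      forall j : 'I_(tag (e i)), nth false J j -> R (xi j) b &
      sval (tagged (e i) xi) b].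
pose choice_op i J (j : nat) xs :=
  if insub j is Some j' then eps _ (fun=> x0) (good i J xs) j' else x0.
pose op (l : nat * Y + nat * (seq bool * nat)) xs :=
  match l with
  | inl (i, y) => val_op i y xs
  | inr (i, (J, j)) => choice_op i J j xs
  end.
have LY : embeds (nat * Y + nat * (seq bool * nat)) Y.
  have countY (C : countType) : embeds C Y.
    by apply: embeds_trans Yinf; exists pickle; exact: (pcan_inj pickleK).
  apply: embeds_sum => //.
  by apply: embeds_prod => //; exists id.
have nth_tuple (T : Type) (t0 : T) i (a : 'I_(tag (e i)) -> T) (j : 'I_(tag (e i))) :
    nth t0 (map a (enum 'I_(tag (e i)))) j = a j.
  by rewrite (nth_map j) ?size_enum_ord// nth_ord_enum.
have mem_tuple B i (a : 'I_(tag (e i)) -> X) : (forall j, op_closure op B (a j)) ->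
    forall x, x \in (map a (enum 'I_(tag (e i))) : seq {classic X}) -> op_closure op B x.
  by move=> aB x /mapP[j _ ->].
exists (op_closure op); split.
- exact: op_closure_base.
- exact: sub_op_closure.
- exact: op_closure_finitary.
- by move=> h P; exact: op_closure_card_le.
split=> [i a B aB z az|i a I b B aB bB /= [xi xiP]].
  have aE : arg i (map a (enum 'I_(tag (e i)))) = a.
    by apply/funext => j; exact: nth_tuple.
  have -> : z = op (inl (i, u (sval (tagged (e i) a)) z)) (map a (enum 'I_(tag (e i)))).
    have [|fz /esym uz] := epsP X x0 z [set z' | sval (tagged (e i) a) z' /\
        u (sval (tagged (e i) a)) z' = u (sval (tagged (e i) a)) z]; first by [].
    rewrite /= /val_op aE; apply: uI uz => //.
    by have /andP[] := svalP (tagged (e i) a).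
  by apply: op_closure_op; exact: mem_tuple.
pose xs := rcons (map a (enum 'I_(tag (e i)))) b.
have xs_nth (j : 'I_(tag (e i))) : nth x0 xs j = a j.
  by rewrite nth_rcons size_map size_enum_ord ltn_ord nth_tuple.
have xs_last : nth x0 xs (tag (e i)) = b.
  by rewrite nth_rcons size_map size_enum_ord ltnn eqxx.
pose Is := map I (enum 'I_(tag (e i))).
have goodE zeta : good i Is xs zeta <-> [/\ forall j, ~~ I j -> zeta j = a j,
    forall j, I j -> R (zeta j) b & sval (tagged (e i) zeta) b].
  rewrite /good xs_last; split=> -[z1 z2 z3]; split=> // j; have := z1 j; have := z2 j;
  by rewrite ?xs_nth nth_tuple.
exists (eps _ (fun=> x0) (good i Is xs)); split.
  by apply/goodE; apply: (epsP _ _ xi); exact/goodE.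
move=> j; have -> : eps _ (fun=> x0) (good i Is xs) j = op (inr (i, (Is, val j))) xs.
  by rewrite /= /choice_op valK.
apply: op_closure_op => x; rewrite mem_rcons in_cons => /predU1P[->//|].
exact: mem_tuple.
Qed.

Section TailIndependence.
Context {X : Type} (cl : set X -> set X).
Hypothesis sub_cl : forall B, B `<=` cl B.
Hypothesis cl_min : forall B B', B `<=` cl B' -> cl B `<=` cl B'.
Hypothesis cl_finitary : forall (h : nat -> X) P x, cl (h @` P) x ->
  exists N, cl (h @` (P `&` [set m | (m < N)%N])) x.

Definition tail_independent (h : nat -> X) : Prop :=
  forall n, ~ cl (h @` [set m | (n < m)%N]) (h n).

Lemma sub_cl_mono (B B' : set X) : B `<=` B' -> cl B `<=` cl B'.
Proof. by move=> BB'; apply: cl_min => x /BB'; exact: sub_cl. Qed.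

Lemma tail_independent_inj h : tail_independent h -> injective h.
Proof.
move=> hI; suff lt_neq m n : (m < n)%N -> h m <> h n.
  move=> m n hmn; apply/eqP; rewrite eqn_leq leqNgt [(n <= m)%N]leqNgt.
  by apply/andP; split; apply/negP => /lt_neq; rewrite hmn.
by move=> mn hmn; apply: (hI m); apply: sub_cl; exists n.
Qed.

(** The entries are minimized one after the other, each with the earlier ones kept. The limit stays
    tail-independent because a dependence involves finitely many entries, which the limit shares
    with some stage. *)
Lemma exists_lex_least (R : X -> X -> Prop) (h0 : nat -> X) : wo_rel R ->
  tail_independent h0 ->
  exists h, tail_independent h /\ forall n u, tail_independent u ->
    agree n h u -> R (h n) (u n).
Proof.
move=> Rwo h0I.
have /choice[f fP] : forall nu : nat * (nat -> X), exists u,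
    tail_independent nu.2 -> [/\ tail_independent u, agree nu.1 nu.2 u &
    forall v, tail_independent v -> agree nu.1 nu.2 v -> R (u nu.1) (v nu.1)].
  move=> [n u] /=; have [uI|nuI] := pselect (tail_independent u); last by exists u.
  pose A := [set v n | v in [set v | tail_independent v /\ agree n u v]].
  have [|_ [[v [vI uv] <-] vmin]] := Rwo.1 A; first by exists (u n), u.
  by exists v => _; split=> // w wI uw; apply: vmin; exists w.
pose fix s k := if k is k'.+1 then f (k', s k') else h0.
have sI k : tail_independent (s k).
  by elim: k => //= k /(fP (k, s k))[].
have s_agree k m : agree k (s k) (s (k + m)).
  elim: m => [|m IH]; first by rewrite addn0.
  rewrite addnS => i ik; have [_ H _] := fP (k + m, s (k + m)) (sI (k + m)).
  by rewrite [LHS](H i (leq_trans ik (leq_addr _ _))); exact: IH.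
pose h n := s n.+1 n.
have hs m : agree m (s m) h.
  move=> i im; have := s_agree i.+1 (m - i.+1) i (ltnSn i).
  by rewrite (subnKC im) /h => ->.
exists h; split=> [n|n u uI hu].
  move=> /cl_finitary[N] clN; apply: (sI (maxn n.+1 N) n).
  rewrite -(hs _ n) ?leq_maxl//; apply: sub_cl_mono clN => _ [m [/= nm mN] <-].
  by exists m => //; rewrite (hs (maxn n.+1 N))// leq_max mN orbT.
have [_ _ /= smin] := fP (n, s n) (sI n).
by apply: smin => // i im; rewrite hu//; exact: hs.
Qed.

End TailIndependence.

(* For a lexicographically least tail-independent [h], let [h n] be in [f xi]
   with some entries of [xi] below [h n]; such a tuple can be chosen inside the
   closure of the [h m] with [n <= m].  One of its entries is outside the closure
   of the [h m] with [n < m], and replacing [h n] by it contradicts minimality. *)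
Lemma tail_independent_mutually (X Y : Type) (F : set (fin_ary_fun X Y))
    (R : X -> X -> Prop) (e : nat -> fin_ary_fun X Y) (cl : set X -> set X) :
  (forall f, F f -> exists i, e i = f) -> wo_rel R ->
  (forall B, B `<=` cl B) ->
  (forall B B', B `<=` cl B' -> cl B `<=` cl B') ->
  (forall (h : nat -> X) P x, cl (h @` P) x ->
     exists N, cl (h @` (P `&` [set m | (m < N)%N])) x) ->
  (forall i (a : 'I_(tag (e i)) -> X) B, (forall j, cl B (a j)) ->
     sval (tagged (e i) a) `<=` cl B) ->
  (forall i (a : 'I_(tag (e i)) -> X) (I : pred 'I_(tag (e i))) b B,
     (forall j, cl B (a j)) -> cl B b ->
     let good xi := [/\ forall j, ~~ I j -> xi j = a j,
         forall j, I j -> R (xi j) b /\ xi j <> b & sval (tagged (e i) xi) b] in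
     (exists xi, good xi) ->
     exists xi, good xi /\ forall j, cl B (xi j)) ->
  (exists h, tail_independent cl h) ->
  exists2 A : set X, A #= [set: nat] & mutually_independent F A.
Proof.
move=> eF Rwo sub_cl cl_min cl_fin cl_val cl_choice [h0 h0I].
have [h [hI hmin]] := exists_lex_least sub_cl cl_min cl_fin Rwo h0I.
have cl_mono := sub_cl_mono sub_cl cl_min.
have h_inj := tail_independent_inj sub_cl hI.
have h_lt m n : (m < n)%N -> R (h m) (h n).
  elim: n => // n IH; rewrite ltnS leq_eqVlt => mn.
  (* Deleting the entry [n] keeps tail-independence, so minimality compares [h n] with [h n.+1]. *)
  suff hn : R (h n) (h n.+1).
    by move: mn => /predU1P[->//|/IH Rmn]; exact: wo_trans hn.
  pose u i := h (if (i < n)%N then i else i.+1).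
  have := hmin n u; rewrite /u ltnn; apply=> [k|i ->//].
  set k' := (if _ then _ else _) => H; apply: (hI k').
  apply: cl_mono H => _ [m' /= km <-]; eexists; last by [].
  by rewrite /k' /=; case: (ltnP k n) => ?; case: (ltnP m' n) => ?; lia.
exists (range h); first by apply: inj_card_eq => x y _ _; exact: h_inj.
move=> _ [n _ <-] f Ff; have [i <-] := eF f Ff => {f Ff} x xA xn.
have /choice[m mP] : forall j, exists m, h m = x j /\ m <> n.
  move=> j; have [[m _ mx] /= xjn] := xA j.
  by exists m; split=> // mn; apply: xjn; rewrite -mx mn.
pose I j := (m j < n)%N.
pose B := h @` [set k | (n <= k)%N].
have clBn : cl B (h n) by apply: sub_cl; exists n => /=.
(* The coordinates in [I] are the free ones, where [a] only needs some element of [cl B]. *)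
pose a j := if I j then h n else x j.
have [j|||xi [[xiI xiR xin] xiB]] := cl_choice i a I (h n) B.
- rewrite /a /I; case: ltnP => // nm; apply: sub_cl.
  by exists (m j) => //; have [] := mP j.
- by [].
- exists x; split=> // j; first by rewrite /a => /negbTE ->.
  have [<- mn] := mP j; rewrite /I => mjn; split; first exact: h_lt.
  by move/h_inj.
have [|/existsNP[j xij]] :=
    pselect (forall j, cl (h @` [set k | (n < k)%N]) (xi j)).
  by move=> /cl_val/(_ _ xin); exact: hI.
have Ij : I j.
  apply: contrapT => /negP nI; apply: xij; rewrite xiI// /a (negbTE nI).
  apply: sub_cl; have [mx mn] := mP j; exists (m j) => //=.
  by move: nI mn; rewrite /I; lia.
have [Rxi xi_n] := xiR j Ij.
pose u k := if k == n then xi j else h k.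
suff uI : tail_independent cl u.
  apply: xi_n; apply: Rwo.2 => //.
  have := hmin n u uI; rewrite /u eqxx; apply=> k kn.
  by rewrite ltn_eqF.
have u_cl k : cl (h @` [set l | (n <= l)%N]) (u k) \/ (k < n)%N.
  rewrite /u; case: eqP => [_|]; first by left.
  by move=> kn; have [/=|] := ltnP k n; [right|left; apply: sub_cl; exists k].
(* Before [n], the later entries stay in the old closure since [xi j] is in [cl B]; at [n], the
   choice of [j] applies; after [n], nothing has changed. *)
move=> k uk; have [kn|] := ltnP k n.
  apply: (hI k); move: uk; rewrite {2}/u ltn_eqF//; apply: cl_min.
  move=> _ [l /= kl <-]; rewrite /u; case: eqP => [_|_].
    by apply: cl_mono (xiB j) => _ [l' /= nl' <-]; exists l' => //=; lia.
  by apply: sub_cl; exists l.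
rewrite leq_eqVlt => /predU1P[nk|nk].
  apply: xij; move: uk; rewrite {2}/u -nk eqxx; apply: cl_mono.
  by move=> _ [l /= nl <-]; exists l => //; rewrite /u gtn_eqF.
apply: (hI k); move: uk; rewrite {2}/u gtn_eqF//; apply: cl_mono.
by move=> _ [l /= kl <-]; exists l => //; rewrite /u gtn_eqF//; lia.
Qed.

(* [right E x] says that some entry of [x] before [E] is in the closure of the
   next [E] entries; the guess is the closure of the first [E] entries, for the
   least such [E].  It is correct at a position of [h] with minimal delay. *)
Lemma uniform_win_closure (X Y : Type) (cl : set X -> set X) :
  (forall B, B `<=` cl B) ->
  (forall B B', B `<=` cl B' -> cl B `<=` cl B') ->
  (forall (h : nat -> X) P x, cl (h @` P) x ->
     exists N, cl (h @` (P `&` [set m | (m < N)%N])) x) ->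
  (forall (h : nat -> X) P, cl (h @` P) #<= [set: Y]) ->
  (forall h, ~ tail_independent cl h) ->
  uniform_win_le X Y.
Proof.
move=> sub_cl cl_min cl_fin cl_card dep.
have cl_mono := sub_cl_mono sub_cl cl_min.
pose delay h n E := cl (h @` [set m | (n < m < n.+1 + E)%N]) (h n).
(* The bound [n < E] makes [right E] depend on the first [E + E] entries only. *)
pose right E x := `[< exists2 n, (n < E)%N & delay x n E >].
have right_ex h : exists E, right E h.
  have /existsNP[n /contrapT/cl_fin[N clN]] := dep h.
  exists (maxn n.+1 N); apply/asboolP; exists n; first exact: leq_maxl.
  apply: cl_mono clN => _ [m [/= nm mN] <-]; exists m => //=.
  by rewrite nm (leq_trans mN)// (leq_trans (leq_maxr n.+1 N))// leq_addl.
have delay_agree E x y n : (n < E)%N -> agree (E + E) x y -> delay x n E -> delay y n E.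
  move=> nE xy; rewrite /delay xy ?ltn_addr//; apply: cl_mono => _ [m /= mE <-].
  by exists m => //; rewrite xy//; lia.
have right_lf E : locally_finite (right E).
  move=> x; exists (E + E) => y xy; apply/idP/idP => /asboolP[n nE dn]; apply/asboolP.
    by exists n => //; apply: delay_agree dn => // i iE; rewrite xy.
  by exists n => //; exact: delay_agree dn.
pose least x := ex_minn (right_ex x).
have least_lf : locally_finite least by exact: locally_finite_ex_minn.
exists (fun x => cl (x @` [set m | (m < least x)%N])); split=> [x|x|h].
- have [N NP] := least_lf x; exists (maxn N (least x)) => y xy.
  have -> : least y = least x by apply: NP; apply: agreeW xy; exact: leq_maxl.
  congr (cl _); apply: eq_imagel => m /= mE; apply: xy.
  exact: leq_trans mE (leq_maxr _ _).
- exact: cl_card.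
- have delay_ex : exists E, `[< exists n, delay h n E >].
    by have [E /asboolP[n _ dn]] := right_ex h; exists E; apply/asboolP; exists n.
  case: (ex_minnP delay_ex) => E /asboolP[n dn] Emin; exists n.
  (* A delay occurring in the tail is also one of [h], at a shifted position, hence at least the
     minimal [E]. *)
  have EE : (E <= least (tail n.+1 h))%N.
    apply: Emin; rewrite /least; case: ex_minnP => E' /asboolP[n' _ dn'] _.
    apply/asboolP; exists (n.+1 + n'); apply: cl_mono dn' => _ [m /= mP <-].
    by exists (n.+1 + m) => //=; lia.
  apply: cl_mono dn => _ [m /= mP <-]; exists (m - n.+1) => /=; first lia.
  by rewrite /tail; congr h; lia.
Qed.

Lemma uniform_win_not_MInA (X Y : Type) : infinite_set [set: Y] ->
  ~ MInA X Y -> uniform_win_le X Y.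
Proof.
move=> /infinite_embeds Yinf /existsNP[F /not_implyP[Fcount Fdep]].
have [[x0]|X0] := pselect (inhabited X); last first.
  exists (fun=> set0); split=> [x|x|h]; first by case: X0; exists; exact: x 0.
    by case: X0; exists; exact: x 0.
  by case: X0; exists; exact: h 0.
have [e eF] : exists e : nat -> fin_ary_fun X Y, forall f, F f -> exists i, e i = f.
  have [y _] := Yinf.
  have empty_small : @set0 X #< [set: Y].
    apply: card_leNgt; rewrite card_le0 => /eqP Y0.
    by have : [set: Y] (y 0) by []; rewrite Y0.
  (* The empty guess fills the indices missed by the enumeration of [F]. *)
  pose f0 : fin_ary_fun X Y :=
    existT (fun n => ('I_n -> X) -> small_set X Y) 0 (fun=> exist _ set0 empty_small).
  have [g [_ gI]] := (card_le_funP F [set: nat] 0).1 Fcount.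
  exists (fun i => xget (f0 : {classic fin_ary_fun X Y}) (F `&` [set f | g f = i])).
  move=> f Ff; exists (g f); case: xgetP => [f' _ [Ff' /= gff']|/(_ f)].
    exact: gI.
  by case.
have [R Rwo] := exists_wo_rel X.
have [cl [sub_cl cl_min cl_fin cl_card [cl_val cl_choice]]] :=
  exists_closure (fun x y => R x y /\ x <> y) e x0 Yinf.
apply: (uniform_win_closure sub_cl cl_min cl_fin cl_card) => h hI.
apply: Fdep; apply: (tail_independent_mutually eF Rwo sub_cl cl_min cl_fin cl_val cl_choice).
by exists h.
Qed.

(** * From uniform strategies to the hat game *)

Lemma MInA_le (K G G' : Type) : [set: G'] #<= [set: G] -> MInA K G -> MInA K G'.
Proof.
move=> G'G KG F Fcount.
have small (A : small_set K G') : sval A #< [set: G].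
  exact: card_lt_le_trans (svalP A) G'G.
pose lift (f : fin_ary_fun K G') : fin_ary_fun K G :=
  existT (fun n => ('I_n -> K) -> small_set K G) (tag f)
    (fun x => exist _ (sval (tagged f x)) (small (tagged f x))).
have [|A Anat Aind] := KG (lift @` F).
  exact: card_le_trans (card_image_le _ _) Fcount.
exists A => // a Aa f Ff x xA.
by apply: (Aind a Aa (lift f)) => //; exists f.
Qed.

Lemma uniform_win_no_MInA (K G : Type) : infinite_set [set: G] ->
  ~ (exists M : Type, [/\ [set: G] #< [set: M], [set: M] #<= [set: K] &
                         strongly_MInA M]) ->
  uniform_win_lt K G.
Proof.
move=> Ginf noM.
(* Subsets of [K] represent all cardinals up to that of [K] inside one type, which allows the
   induction. *)
suff winA (A : set K) : uniform_win_lt A G.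
  apply: (uniform_win_embeds _ (winA setT)).
  by apply/embedsP; rewrite (card_le_eqr (card_setT _)).
elim/card_lt_ind: A => A IH.
have [AG|nAG] := pselect ([set: A] #<= [set: G]).
  by apply: uniform_win_embeds (uniform_win_self Ginf); exact/embedsP.
have GA : [set: G] #< [set: A] by exact: card_leNgt.
have [Y [Yinf GY YA nMInA]] : exists Y : Type, [/\ infinite_set [set: Y],
    [set: G] #<= [set: Y], [set: Y] #< [set: A] & ~ MInA A Y].
  have AK : [set: A] #<= [set: K].
    by rewrite (card_le_eql (card_setT _)); exact: card_leT.
  have nA : ~ strongly_MInA A by move=> sA; apply: noM; exists (set_type A).
  have Ainf : infinite_set [set: A].
    move=> Afin; apply: Ginf; apply: card_le_finite Afin.
    by have /andP[] := GA.
  have /existsNP[G' /not_implyP[G'inf /not_implyP[G'A nG']]] :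
    ~ forall G' : Type, infinite_set [set: G'] -> [set: G'] #< [set: A] -> MInA A G'.
    by move=> H; apply: nA.
  (* Failure of the MInA passes to larger bounds, so a [G'] below [G] is replaced by [G]. *)
  have [GG'|G'G] := card_le_total [set: G] [set: G']; first by exists G'.
  by exists G; split=> // /(MInA_le G'G).
apply: (uniform_win_comp _ (uniform_win_not_MInA Yinf nMInA)).
  by have [y _] := infinite_setN0 Yinf; exists.
have [f fI] : embeds Y A by apply/embedsP; case/andP: YA.
pose B := range (fun y => val (f y)).
have YB : [set: Y] #= B.
  by apply/card_esym/inj_card_eq => x y _ _ /val_inj/fI.
move: YB; rewrite card_eq_le => /andP[YB BY].
apply: (uniform_win_embeds _ (IH B _)).
  by apply/embedsP; rewrite (card_le_eqr (card_setT _)).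
apply: card_le_lt_trans BY (card_lt_le_trans YA _).
by rewrite (card_le_eql (card_setT _)).
Qed.

(** Cylinders over finite sets of coordinates are neighbourhoods since projections are continuous;
    conversely, the filter they generate converges to [h] in each coordinate. *)
Lemma nbhs_ptws_discrete (I : Type) (K : choiceType)
    (h : {ptws I -> discrete_topology K}) (A : set {ptws I -> discrete_topology K}) :
  nbhs h A <-> exists D : seq I, forall h' : {ptws I -> discrete_topology K},
    (forall i, i \in (D : seq {classic I}) -> h' i = h i) -> A h'.
Proof.
pose F : set_system {ptws I -> discrete_topology K} :=
  [set A | exists D : seq I, forall h' : {ptws I -> discrete_topology K},
    (forall i, i \in (D : seq {classic I}) -> h' i = h i) -> A h'].
have F_filter : Filter F.
  split.
  - by exists [::].
  - move=> B C [D DB] [E EC]; exists (D ++ E) => h' hDE; split.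
      by apply: DB => i iD; apply: hDE; rewrite mem_cat iD.
    by apply: EC => i iE; apply: hDE; rewrite mem_cat iE orbT.
  - by move=> B C BC [D DB]; exists D => h' /DB/BC.
split; last first.
  move=> [D DA]; apply: filterS DA _.
  elim: D => [|i D IH]; first by apply: filterS filterT => h' _ i.
  have hi : nbhs h [set h' : {ptws I -> discrete_topology K} | h' i = h i].
    have := @proj_continuous {classic I} (fun=> discrete_topology K) i h.
    by move=> /(_ [set h i]); apply; exact: discrete_set1.
  apply: filterS (filterI hi IH) => h' [h'i h'D] j.
  by rewrite in_cons => /predU1P[->//|]; exact: h'D.
suff F_cvg : F --> h by exact: F_cvg.
apply/cvg_sup => i; apply/cvg_image.
  by rewrite eqEsubset; split=> v // _; exists (cst v).
move=> W /= /nbhs_singleton Wh; exists [set h' | W (h' i)].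
  by exists [:: i] => h' /(_ i (mem_head _ _)) /= ->.
by rewrite eqEsubset; split=> [v [? + <-]//|v Wv]; exists (cst v).
Qed.

Lemma continuous_discreteP (I : Type) (K T : choiceType)
    (f : {ptws I -> discrete_topology K} -> discrete_topology T) :
  continuous f <-> forall h : {ptws I -> discrete_topology K},
    exists D : seq I, forall h' : {ptws I -> discrete_topology K},
    (forall i, i \in (D : seq {classic I}) -> h' i = h i) -> f h' = f h.
Proof.
split=> [fc h|flf h].
  have : (f @ h) [set f h] by apply: fc; exact: discrete_set1.
  by move=> /(nbhs_ptws_discrete h)[D DA]; exists D => h' hD; exact: DA.
have [D DP] := flf h => W /nbhs_singleton Wfh.
have : nbhs h (f @^-1` W); last by exact.
by apply/nbhs_ptws_discrete; exists D => h' /DP; rewrite /preimage /= => ->.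
Qed.

Section Games.
Context {d : Order.disp_t} (P : porderType d) (K G : Type).

(** Logicians off the sequence guess nothing; those on it recover their index, which is unique
    because [s] is strictly increasing. *)
Lemma uniform_win_hat_game (s : nat -> P) : infinite_set [set: G] ->
  (forall m n : nat, (m < n)%N -> (s m < s n)%O) ->
  uniform_win_lt K G -> hat_game_winning P K G.
Proof.
move=> Ginf s_lt [Phi [Phi_lf Phi_small Phi_win]].
have small0 : @set0 K #< [set: G].
  apply: card_leNgt; rewrite card_le0 => /eqP G0; apply: Ginf.
  by rewrite G0; exact: finite_set0.
have s_above p n (np : p = s n) i : (p < s (n.+1 + i))%O.
  by rewrite np; apply: s_lt; exact: leq_addr.
pose next p n (np : p = s n) i : above p := exist _ (s (n.+1 + i)) (s_above p n np i).
pose see p n (np : p = s n) (h : {ptws above p -> discr K}) : nat -> K :=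
  fun i => h (next p n np i).
pose f : guess_family P K G := fun p h =>
  if pselect (exists n, p = s n) is left e then
    exist _ (Phi (see _ _ (projT2 (cid e)) h)) (Phi_small _)
  else exist _ set0 small0.
exists f; split=> [p|h].
  apply/continuous_discreteP => h; rewrite /f; case: pselect => [e|_]; last by exists [::].
  move: (projT1 _) (projT2 (cid e)) => n np.
  have [N NP] := Phi_lf (see _ _ np h).
  exists (map (next p n np) (iota 0 N)) => h' hD.
  apply: eq_exist => /=; apply: NP => i iN; apply: hD.
  by apply: map_f; rewrite mem_iota.
have [n hn] := Phi_win (h \o s); exists (s n); rewrite /f.
case: pselect => [e|]; last by case; exists n.
move: (projT1 _) (projT2 (cid e)) => m mn /=.
have nm : m = n.
  by case: (ltngtP m n) => // /s_lt; rewrite mn Order.POrderTheory.ltxx.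
subst m; suff -> : see _ _ mn (@restrict_above d P K h (s n)) = tail n.+1 (h \o s).
  exact: hn.
by apply/funext => i.
Qed.

Lemma card_lt_hat_game : [set: P] !=set0 -> [set: K] #< [set: G] -> hat_game_winning P K G.
Proof.
move=> [p _] KG; exists (fun _ _ => exist _ setT KG); split=> [q|h].
  exact: cst_continuous.
by exists p.
Qed.

End Games.

(** * Losing colourings *)

(** Guesses read total colourings, which avoids domains depending on [p]; the visibility relation
    [S] may be smaller than the order. *)
Definition local_guess (P : eqType) (K : Type) (S : P -> set P)
    (phi : P -> (P -> K) -> set K) : Prop :=
  forall p h, exists2 D : seq P, (forall q, q \in D -> S p q) &
    forall h', (forall q, q \in D -> h' q = h q) -> phi p h' = phi p h.

(** * Decision trees of queries *)

Section DecisionTree.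
Context {P : eqType} {K : Type} (S : P -> set P) (phi : P -> (P -> K) -> set K).

Definition decided (w : P) (qs : seq P) (xs : seq K) : Prop :=
  forall h h', map h qs = xs -> map h' qs = xs -> phi w h = phi w h'.

(* Undecided states query supports of two colourings with different guesses:
   one of these guesses differs from the true one, so that its support and any
   support of the true colouring share an unqueried point. *)
Lemma exists_queries : local_guess S phi ->
  exists next : P -> seq P -> seq K -> seq P,
  (forall w qs xs q, q \in next w qs xs -> S w q) /\
  (forall w h (D : seq P), (forall h', (forall q, q \in D -> h' q = h q) -> phi w h' = phi w h) ->
     forall qs, ~ decided w qs (map h qs) ->
     exists q, [/\ q \in D, q \in next w qs (map h qs) & q \notin qs]).
Proof.
move=> phi_loc.
have /choice[supp suppP] : forall ph : P * (P -> K), exists D : seq P,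
    (forall q, q \in D -> S ph.1 q) /\
    forall h', (forall q, q \in D -> h' q = ph.2 q) -> phi ph.1 h' = phi ph.1 ph.2.
  by move=> [p h]; have [D] := phi_loc p h; exists D.
have /choice[next nextP] : forall u : P * seq P * seq K, exists qs : seq P,
    (forall q, q \in qs -> S u.1.1 q) /\
    (~ decided u.1.1 u.1.2 u.2 -> exists h1 h2,
      [/\ map h1 u.1.2 = u.2, map h2 u.1.2 = u.2, phi u.1.1 h1 <> phi u.1.1 h2 &
          qs = supp (u.1.1, h1) ++ supp (u.1.1, h2)]).
  move=> [[w qs] xs] /=; have [dec|] := pselect (decided w qs xs).
    by exists [::]; split.
  move=> /existsNP[h1 /existsNP[h2 /not_implyP[E1 /not_implyP[E2 ne]]]].
  exists (supp (w, h1) ++ supp (w, h2)); split; last by exists h1, h2.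
  by move=> q; rewrite mem_cat => /orP[] /(suppP (w, _)).1.
exists (fun w qs xs => next (w, qs, xs)); split.
  by move=> w qs xs q /(nextP (w, qs, xs)).1.
move=> w h D DP qs ndec.
have [_ /(_ ndec)[h1 [h2 [/= E1 E2 ne nextE]]]] := nextP (w, qs, map h qs).
have [h' [E' ne' sub']] : exists h', [/\ map h' qs = map h qs, phi w h' <> phi w h &
    {subset supp (w, h') <= next (w, qs, map h qs)}].
  have [e1|ne1] := pselect (phi w h1 = phi w h).
    exists h2; split=> //; first by rewrite -e1; exact/nesym.
    by move=> q q2; rewrite nextE mem_cat q2 orbT.
  by exists h1; split=> // q q1; rewrite nextE mem_cat q1.
have [q [qD qs' hq]] : exists q, [/\ q \in D, q \in supp (w, h') & h' q <> h q].
  apply: contrapT => noq; apply: ne'.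
  (* If [h] and [h'] agreed wherever both supports meet, this mixture would produce both guesses. *)
  pose m q := if q \in D then h q else h' q.
  rewrite -(DP m); last by move=> q qD; rewrite /m qD.
  apply/esym; apply: (suppP (w, h')).2 => q qs'; rewrite /m; case: ifP => // qD.
  by apply: contrapT => hq; apply: noq; exists q; split=> //; exact/nesym.
exists q; split=> //; first exact: sub'.
by apply/negP => qqs; apply: hq; move/eq_in_map: E'; apply.
Qed.

Context (next : P -> seq P -> seq K -> seq P).

Fixpoint queries (w : P) (h : P -> K) (k : nat) : seq P :=
  if k is k'.+1 then
    let qs := queries w h k' in
    qs ++ (if pselect (decided w qs (map h qs)) then [::] else next w qs (map h qs))
  else [::].

Lemma queries_le w h j k : (j <= k)%N -> exists t, queries w h k = queries w h j ++ t.
Proof.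
elim: k => [|k IH]; first by rewrite leqn0 => /eqP ->; exists [::].
rewrite leq_eqVlt => /predU1P[->|/IH[t tE]]; first by exists [::]; rewrite cats0.
by rewrite /= tE -!catA; eexists; reflexivity.
Qed.

Lemma queries_decided w h j k : (j <= k)%N ->
  decided w (queries w h j) (map h (queries w h j)) -> queries w h k = queries w h j.
Proof.
move=> + dec; elim: k => [|k IH]; first by rewrite leqn0 => /eqP ->.
rewrite leq_eqVlt => /predU1P[->//|/IH E] /=.
case: pselect => [d|nd]; first by rewrite cats0.
by case: nd; rewrite E.
Qed.

Lemma queries_local w h h' k : (forall q, q \in queries w h k -> h' q = h q) ->
  queries w h' k = queries w h k.
Proof.
elim: k => //= k IH hh'.
have hE q : q \in queries w h k -> h' q = h q.
  by move=> qk; apply: hh'; rewrite mem_cat qk.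
rewrite IH//; have -> // : map h' (queries w h k) = map h (queries w h k).
exact/eq_in_map.
Qed.

(** Each round of queries depends only on the answers to the earlier rounds. *)
Lemma queries_answers w h h' k :
  map h (queries w h k) = map h' (queries w h' k) -> queries w h k = queries w h' k.
Proof.
move=> E; suff : forall j, (j <= k)%N -> queries w h j = queries w h' j by apply.
elim=> //= j IH jk; have {}IH := IH (ltnW jk).
have -> : map h (queries w h j) = map h' (queries w h' j); last by rewrite IH.
have [t tE] := queries_le w h (ltnW jk); have [t' t'E] := queries_le w h' (ltnW jk).
move: E; rewrite tE t'E !map_cat => /(congr1 (take (size (queries w h j)))).
by rewrite !take_size_cat ?size_map// IH.
Qed.

(** Each undecided round queries a new point of the finite list [D], so the number of its unqueried
    entries drops. *)
Lemma queries_halt w h (D : seq P) :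
  (forall qs, ~ decided w qs (map h qs) ->
     exists q, [/\ q \in D, q \in next w qs (map h qs) & q \notin qs]) ->
  exists k, decided w (queries w h k) (map h (queries w h k)).
Proof.
move=> next_new; apply: contrapT => /forallNP ndec.
pose left k := count (fun q => q \notin queries w h k) D.
have left_lt k : (left k.+1 < left k)%N.
  have [q [qD qnext qnew]] := next_new _ (ndec k).
  rewrite /left -!size_filter; set s := [seq q <- D | q \notin queries w h k].
  have -> : [seq q <- D | q \notin queries w h k.+1] =
      [seq q <- s | q \notin queries w h k.+1].
    rewrite -filter_predI; apply: eq_filter => x /=; rewrite mem_cat negb_or.
    by case: (x \in queries w h k); rewrite ?andbT ?andbF.
  rewrite size_filter -(count_predC (fun q => q \notin queries w h k.+1) s).
  rewrite -addn1 leq_add2l -has_count; apply/hasP; exists q.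
    by rewrite mem_filter qnew.
  by rewrite /= negbK mem_cat; case: pselect => [/[dup]/ndec//|nd]; rewrite qnext orbT.
have : (left (left 0).+1 + (left 0).+1 <= left 0)%N.
  elim: (left 0).+1 => [|k IH]; first by rewrite addn0.
  by rewrite addnS -addSn (leq_trans _ IH)// leq_add2r.
by rewrite addnS ltnNge leq_addl.
Qed.

Lemma queries_visible w h k :
  (forall qs xs q, q \in next w qs xs -> S w q) ->
  forall q, q \in queries w h k -> S w q.
Proof.
move=> nextS; elim: k => //= k IH q; rewrite mem_cat => /orP[/IH//|].
by case: pselect => // nd /nextS.
Qed.

End DecisionTree.

(** * Enumeration of the points queried from [p0] onwards *)

Section Unravelling.
Context {P : eqType} {K : Type} (phi : P -> (P -> K) -> set K).
Context (next : P -> seq P -> seq K -> seq P) (p0 : P) (c : K).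
Implicit Types (a : nat -> K) (q w : P).

Definition color a (L : seq P) q : K := if q \in L then a (index q L) else c.

(** New points are appended, so indices and colours never change; the number of rounds grows with
    the stage, so that every query is eventually included. *)
Fixpoint points a (n : nat) : seq P :=
  if n is n'.+1 then
    let L := points a n' in
    L ++ [seq q <- undup (flatten [seq queries phi next w (color a L) n' | w <- L])
         | q \notin L]
  else [:: p0].

Lemma points_le a m n : (m <= n)%N -> exists t, points a n = points a m ++ t.
Proof.
elim: n => [|n IH]; first by rewrite leqn0 => /eqP ->; exists [::].
rewrite leq_eqVlt => /predU1P[->|/IH[t tE]]; first by exists [::]; rewrite cats0.
by rewrite /= tE -!catA; eexists; reflexivity.
Qed.

Lemma sub_points a m n : (m <= n)%N -> {subset points a m <= points a n}.
Proof. by move=> /(points_le a)[t ->] q qm; rewrite mem_cat qm. Qed.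

(** A list of at most [i] points uses only colours [a j] with [j < i], so its next stage is the same
    for [a']; a longer list already contains the first [i.+1] points. *)
Lemma points_agree i a a' n : agree i a a' ->
  take i.+1 (points a' n) = take i.+1 (points a n).
Proof.
move=> aa'; elim: n => // n IH.
have [size_le|size_gt] := leqP (size (points a n)) i; last first.
  have size_gt' : (i < size (points a' n))%N.
    have := congr1 size IH; rewrite !size_take_min; move: size_gt; lia.
  by rewrite /= !takel_cat ?IH.
have E : points a' n = points a n.
  have size_le' : (size (points a' n) <= i)%N.
    have := congr1 size IH; rewrite !size_take_min; move: size_le; lia.
  by move: IH; rewrite !take_oversize ?(leq_trans _ (leqnSn i)).
rewrite /= E; have -> // : color a' (points a n) = color a (points a n).
apply/funext => q; rewrite /color; case: ifP => // qL.
by apply: aa'; rewrite (leq_trans _ size_le)// index_mem.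
Qed.

Definition limit_color a q : K :=
  if pselect (exists n, q \in points a n) is left e
  then color a (points a (projT1 (cid e))) q else c.

Lemma limit_colorE a n q : q \in points a n -> limit_color a q = color a (points a n) q.
Proof.
have color_le m k : (m <= k)%N -> q \in points a m ->
    color a (points a k) q = color a (points a m) q.
  move=> mk qm; rewrite /color qm (sub_points mk qm).
  by have [t ->] := points_le a mk; rewrite index_cat qm.
move=> qn; rewrite /limit_color; case: pselect => [e|]; last by case; exists n.
move: (projT1 _) (projT2 (cid e)) => m qm.
by have [mn|/ltnW nm] := leqP m n; [rewrite (color_le m n)|rewrite (color_le n m)].
Qed.

(** Once a stage contains [w] and its first [k] rounds, its colouring gives the same next round as
    the limit; a stage number above [k] ensures that this round is run. *)
Lemma queries_points a n w k : w \in points a n ->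
  exists m, {subset queries phi next w (limit_color a) k <= points a m}.
Proof.
move=> wn; elim: k => [|k [m IH]]; first by exists 0.
pose N := maxn (maxn m n) k.+1; exists N.+1 => q qk.
have colorE : queries phi next w (color a (points a N)) k =
    queries phi next w (limit_color a) k.
  apply: queries_local => p pk; apply/esym/limit_colorE/(sub_points _ (IH p pk)).
  by rewrite !leq_max leqnn.
have answersE : map (color a (points a N)) (queries phi next w (limit_color a) k) =
    map (limit_color a) (queries phi next w (limit_color a) k).
  apply/eq_in_map => p pk; apply/esym/limit_colorE/(sub_points _ (IH p pk)).
  by rewrite !leq_max leqnn.
have {}qk : q \in queries phi next w (color a (points a N)) k.+1.
  by rewrite /= colorE answersE.
rewrite /= mem_cat mem_filter mem_undup; have [//|qN /=] := boolP (q \in points a N).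
apply/flattenP; exists (queries phi next w (color a (points a N)) N).
  by apply: map_f; apply: sub_points wn; rewrite !leq_max leqnn orbT.
have [|t ->] := queries_le phi next w (color a (points a N)) (j := k.+1) (k := N).
  by rewrite leq_max leqnn orbT.
by rewrite mem_cat qk.
Qed.

End Unravelling.

(* The points queried from [p0] onwards are enumerated and coloured along an
   independent sequence [a]: the [i]-th point depends only on the [a j] with
   [j < i], and its guess only on the answers to its own queries, which are
   values of [a] other than [a i].  Hence [a i] is not guessed. *)
Lemma countable_losing (P : eqType) (K G : Type) (S : P -> set P)
    (phi : P -> (P -> K) -> set K) (p0 : P) :
  local_guess S phi -> (forall p, ~ S p p) -> (forall p h, phi p h #< [set: G]) ->
  MInA K G ->
  exists W : set P, exists h : P -> K,
    [/\ W p0, forall w, W w -> w = p0 \/ exists p, S p w &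
        forall w, W w -> forall h', (forall q, W q -> h' q = h q) -> ~ phi w h' (h w)].
Proof.
move=> phi_loc S_irr phi_small KG.
have [next [next_S next_new]] := exists_queries phi_loc.
have [c _] : [set: K] !=set0.
  have [|A Anat _] := KG set0; first exact: countable0.
  have [a _] : A !=set0.
    by apply: infinite_setN0; apply/infiniteP; move: Anat; rewrite card_eq_le => /andP[].
  by exists a.
have small0 : @set0 K #< [set: G].
  apply: card_le_lt_trans (phi_small p0 (fun=> c)); exact: card_ge0.
pose Q w h k := queries phi next w h k.
pose ext i (b : 'I_i -> K) : nat -> K := fun j => if insub j is Some j' then b j' else c.
(* A logician and the answers determine the run, hence the guess once decided; runs of different
   lengths are compared at [maxn k0 k]. *)
have /choice[val valP] : forall u : P * seq K, exists A : small_set K G,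
    forall h k, map h (Q u.1 h k) = u.2 -> decided phi u.1 (Q u.1 h k) u.2 ->
    sval A = phi u.1 h.
  move=> [w X] /=.
  have [[h0 [k0 [E0 D0]]]|none] := pselect (exists h k,
      map h (Q w h k) = X /\ decided phi w (Q w h k) X); last first.
    by exists (exist _ set0 small0) => h k E D; case: none; exists h, k.
  exists (exist _ (phi w h0) (phi_small w h0)) => h k E D /=.
  have E0' := queries_decided (j := k0) (k := maxn k0 k) (leq_maxl _ _).
  rewrite -E0 in D0; rewrite -E in D.
  have {}E0' := queries_decided (next := next) (leq_maxl k0 k) D0.
  have E' := queries_decided (next := next) (leq_maxr k0 k) D.
  have QQ : Q w h0 k0 = Q w h k.
    by rewrite /Q -E0' -E'; apply: queries_answers; rewrite E0' E' -/(Q _ _ _) E0 E.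
  by apply: D0 => //; rewrite QQ E -E0 QQ.
(* The index [(i, n, l)] stands for the [i]-th point of stage [n] after [l] answers: the first [i]
   arguments are the colours determining this point, the last [l] the answers. *)
pose f (u : nat * nat * nat) : fin_ary_fun K G :=
  existT (fun n => ('I_n -> K) -> small_set K G) (u.1.1 + u.2)
    (fun x => val (nth p0 (points phi next p0 c (ext _ (fun j => x (lshift u.2 j))) u.1.2) u.1.1,
                   [seq x (rshift u.1.1 j) | j <- enum 'I_u.2])).
have [|A Anat Aind] := KG (range f).
  apply: card_le_trans (card_image_le _ _) _; exact: countableP.
have [a aA aI] : exists2 a : nat -> K, forall n, A (a n) & injective a.
  move: Anat; rewrite card_eq_le => /andP[_ /(card_le_funP _ _ c)[a [aA aI]]].
  by exists a => [n|x y]; [exact: aA|exact: aI].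
pose pts := points phi next p0 c a; pose h := limit_color phi next p0 c a.
have hE n q : q \in pts n -> h q = a (index q (pts n)).
  by move=> qn; rewrite /h (limit_colorE qn) /color -/(pts n) qn.
exists [set q | exists n, q \in pts n], h; split.
- by exists 0; rewrite mem_head.
- move=> w [n]; elim: n => [|n IH]; first by rewrite mem_seq1 => /eqP ->; left.
  rewrite /pts /= mem_cat => /orP[/IH//|].
  rewrite mem_filter mem_undup => /andP[_ /flattenP[_ /mapP[p _ ->]]].
  by move=> /(queries_visible (next_S p)) Sp; right; exists p.
move=> w [n wn] h' hh'.
have [D _ DP] := phi_loc w h.
have [k dec] := queries_halt (next := next) (fun qs => next_new w h D DP qs).
have [m km] := queries_points k wn.
have -> : phi w h' = phi w h.
  by apply: dec => //; apply/eq_in_map => q qk; apply: hh'; exists m; exact: km.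
set X := map h _ in dec; pose i := index w (pts n).
have hw : h w = a i by exact: hE.
pose x (j : 'I_(i + size X)) : K :=
  match fintype.split j with inl j' => a j' | inr j' => nth c X j' end.
have xr j : x (rshift i j) = nth c X j.
  by rewrite /x -[rshift i j]/(unsplit (inr j)) unsplitK.
have xl j : x (lshift (size X) j) = a j.
  by rewrite /x -[lshift _ j]/(unsplit (inl j)) unsplitK.
have xX : [seq x (rshift i j) | j <- enum 'I_(size X)] = X.
  apply: (@eq_from_nth _ c); first by rewrite size_map size_enum_ord.
  move=> j; rewrite size_map size_enum_ord => jX.
  by rewrite (nth_map (Ordinal jX)) ?size_enum_ord// xr nth_enum_ord.
have xa : agree i a (ext _ (fun j => x (lshift (size X) j))).
  by move=> j ji; rewrite /ext insubT xl.
have wE : nth p0 (points phi next p0 c (ext _ (fun j => x (lshift (size X) j))) n) i = w.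
  by rewrite -(nth_take (n0 := i.+1))// (points_agree _ _ _ _ _ xa) nth_take// nth_index.
rewrite hw; move: (Aind (a i) (aA i) (f (i, n, size X)) (imageT _ _) x) => /=.
rewrite xX wE (valP (w, X) h k)//; apply=> j.
rewrite -(fintype.splitK j); case: (fintype.split j) => j' /=.
  rewrite xl; split; first exact: aA.
  by move=> /aI ji; have := ltn_ord j'; rewrite ji ltnn.
rewrite xr.
have jX : (j' < size (queries phi next w h k))%N.
  by rewrite -(size_map h); exact: ltn_ord.
rewrite (nth_map p0)//; set q := nth p0 _ j'.
have qk : q \in queries phi next w h k by exact: mem_nth.
(* At a stage containing both points, equal colours mean equal indices, so a query coloured [a i]
   would be [w], which [w] does not see. *)
have qm := sub_points (leq_maxl m n) (km q qk).
have wm := sub_points (leq_maxr m n) wn.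
rewrite (hE _ _ qm); split; first exact: aA.
rewrite -hw (hE _ _ wm) => /aI /(index_inj p0 qm) qw.
by have := queries_visible (next_S w) qk; rewrite (qw wm) => /S_irr.
Qed.

Lemma mem_classic (T : eqType) (x : T) (s : seq T) :
  x \in s <-> x \in (s : seq {classic T}).
Proof.
elim: s => [//|y s IH]; rewrite !in_cons.
by split=> /predU1P[->|/IH xs]; apply/predU1P; [left|right|left|right].
Qed.

(** * Extension of losing partial colourings, and compactness *)

Section Losing.
Context {d : Order.disp_t} (P : porderType d) {K : Type} (phi : P -> (P -> K) -> set K).

Definition extends (g : set (P * K)) (h : P -> K) : Prop :=
  forall p a, g (p, a) -> h p = a.

Definition losing_graph (g : set (P * K)) : Prop :=
  (forall p a b, g (p, a) -> g (p, b) -> a = b) /\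
  forall p a, g (p, a) -> forall h, extends g h -> ~ phi p h a.

(** Losing concerns all total extensions, so it passes to unions of chains; a maximal losing graph
    is total by the extension hypothesis. *)
Lemma losing_extension :
  (forall g p, losing_graph g -> (forall a, ~ g (p, a)) ->
     exists g', [/\ losing_graph g', g `<=` g' & exists q a, g' (q, a) /\ ~ g (q, a)]) ->
  exists h : P -> K, forall p, ~ phi p h (h p).
Proof.
move=> step.
have [|g [gl gmax]] := @Zorn_bigcup _ losing_graph.
  move=> C Cl Ctot; split=> [p a b [X CX Xa] [Y CY Yb]|p a [X CX Xa] h hC].
    have [XY|YX] := Ctot X Y CX CY.
      exact: (Cl Y CY).1 (XY _ Xa) Yb.
    exact: (Cl X CX).1 Xa (YX _ Yb).
  by apply: (Cl X CX).2 Xa _ _ => q b Xq; apply: hC; exists X.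
have /choice[h hg] : forall p, exists a, g (p, a).
  move=> p; apply: contrapT => /forallNP gp.
  have [g' [g'l gg' [q [a [g'q gq]]]]] := step g p gl gp.
  by apply: gmax g'l; split=> // g'g; apply: gq; exact: g'g.
by exists h => p; apply: gl.2 (hg p) _ _ => q a gq; exact: gl.1 (hg q) gq.
Qed.

Hypothesis phi_local : local_guess (fun p q => (p < q)%O) phi.

Lemma extends_exists (g : set (P * K)) (k : K) : losing_graph g -> exists h, extends g h.
Proof.
move=> [gfun _].
have /choice[h hP] : forall p, exists a, forall b, g (p, b) -> a = b.
  move=> p; have [[a ga]|gp] := pselect (exists a, g (p, a)).
    by exists a => b; exact: gfun.
  by exists k => b gb; case: gp; exists b.
by exists h.
Qed.

(** Without increasing sequences some uncoloured point is maximal. All that it sees is coloured, so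
    its guess is fixed and misses some colour. *)
Lemma losing_noetherian : [set: K] !=set0 -> (forall p h, ~ (setT `<=` phi p h)) ->
  ~ (exists s : nat -> P, forall m n : nat, (m < n)%N -> (s m < s n)%O) ->
  exists h : P -> K, forall p, ~ phi p h (h p).
Proof.
move=> [k _] phi_nT no_seq; apply: losing_extension => g p0 gl gp0.
have [p [gp pmax]] : exists p, (forall a, ~ g (p, a)) /\
    forall q, (p < q)%O -> exists a, g (q, a).
  apply: contrapT => nomax; apply: no_seq.
  have /choice[f fP] : forall p, exists q, (forall a, ~ g (p, a)) ->
      (p < q)%O /\ forall a, ~ g (q, a).
    move=> p; have [gp|gp] := pselect (forall a, ~ g (p, a)); last by exists p.
    have [[q [pq gq]]|noq] := pselect (exists q, (p < q)%O /\ forall a, ~ g (q, a)).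
      by exists q.
    case: nomax; exists p; split=> // q pq; apply: contrapT => gq; apply: noq.
    by exists q; split=> // a ga; apply: gq; exists a.
  pose s n := iter n f p0.
  have sP n : forall a, ~ g (s n, a) by elim: n => //= n /fP[].
  exists s => m n; elim: n => // n IH; rewrite ltnS leq_eqVlt.
  have sn := (fP _ (sP n)).1.
  by move=> /predU1P[->|/IH mn]; last exact: Order.POrderTheory.lt_trans sn.
have [h hg] := extends_exists k gl.
have /existsNP[c /not_implyP[_ cP]] := phi_nT p h.
exists (g `|` [set (p, c)]); split.
- split=> [q a b|q a].
    move=> [ga|[qp ac]] [gb|[qp' bc]].
    + exact: gl.1 ga gb.
    + by case: (gp a); rewrite -qp'.
    + by case: (gp b); rewrite -qp.
    + by rewrite ac bc.
  case=> [ga|[-> ->]] h' h'g.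
    by apply: gl.2 ga _ _ => p' b gb; apply: h'g; left.
  have [D Dp DP] := phi_local p h; rewrite DP// => r /Dp /pmax[b gb].
  by rewrite (hg _ _ gb); apply: h'g; left.
- by move=> x gx; left.
- by exists p, c; split; [right|exact: gp].
Qed.

(** Substituting the colours of [g] by [fill] leaves a local game in which only uncoloured points
    are visible, so [countable_losing] colours [p0] and further uncoloured points. *)
Lemma losing_MInA (G : Type) : (forall p h, phi p h #< [set: G]) -> MInA K G ->
  exists h : P -> K, forall p, ~ phi p h (h p).
Proof.
move=> phi_small KG; apply: losing_extension => g p0 gl gp0.
have /choice[fill fillP] : forall h : P -> K, exists h' : P -> K,
    extends g h' /\ forall q, (forall a, ~ g (q, a)) -> h' q = h q.
  move=> h; have [h0 h0g] := extends_exists (h p0) gl.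
  exists (fun q => if pselect (exists a, g (q, a)) then h0 q else h q); split.
    by move=> q a ga; case: pselect => [e|]; [exact: h0g|case; exists a].
  by move=> q gq; case: pselect => // e; have [a /gq] := e.
have fill_id h : extends g h -> fill h = h.
  move=> hg; apply/funext => q; have [fg fE] := fillP h.
  have [[a ga]|gq] := pselect (exists a, g (q, a)); first by rewrite (fg _ _ ga) (hg _ _ ga).
  by apply: fE => a ga; apply: gq; exists a.
pose free q := forall a, ~ g (q, a).
pose S p q := (p < q)%O /\ free q.
have S_local : local_guess S (fun p h => phi p (fill h)).
  move=> p h; have [D Dp DP] := phi_local p (fill h).
  exists [seq q <- D | `[< free q >]].
    by move=> q; rewrite mem_filter => /andP[/asboolP fq /Dp].
  move=> h' hh'; apply: DP => q qD.
  have [fq|/existsNP[a /contrapT ga]] := pselect (free q).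
    rewrite (fillP h').2// (fillP h).2//; apply: hh'.
    by rewrite mem_filter qD andbT; exact/asboolP.
  by rewrite ((fillP h').1 _ _ ga) ((fillP h).1 _ _ ga).
have [|p h|W [h [Wp0 WS Wlose]]] := countable_losing p0 S_local _ _ KG.
- by move=> p []; rewrite Order.POrderTheory.ltxx.
- exact: phi_small.
have Wfree w : W w -> free w by move=> /WS[->//|[p []]].
exists (g `|` [set x | W x.1 /\ x.2 = h x.1]); split.
- split=> [q a b|q a].
    move=> [ga|[/= Wq ->]] [gb|[/= Wq' ->]] //.
    + exact: gl.1 ga gb.
    + by case: (Wfree _ Wq' a).
    + by case: (Wfree _ Wq b).
  move=> ga h' h'g; have h'g0 : extends g h' by move=> p b gb; apply: h'g; left.
  case: ga => [ga|[/= Wq ->]]; first exact: gl.2 ga _ h'g0.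
  by rewrite -(fill_id _ h'g0); apply: Wlose => // w Ww; apply: h'g; right.
- by move=> x gx; left.
- by exists p0, (h p0); split; [right|exact: gp0].
Qed.

Lemma exists_minimal (p : P) (Q : seq P) :
  exists q, q \in p :: Q /\ forall r, r \in p :: Q -> ~~ (r < q)%O.
Proof.
elim: Q p => [|p' Q IH] p.
  exists p; split; first exact: mem_head.
  by move=> r; rewrite mem_seq1 => /eqP ->; rewrite Order.POrderTheory.ltxx.
have [q [qQ qmin]] := IH p'.
have [pq|pq] := boolP (p < q)%O; last first.
  exists q; split; first by rewrite in_cons qQ orbT.
  by move=> r; rewrite in_cons => /predU1P[->//|]; exact: qmin.
exists p; split; first exact: mem_head.
move=> r; rewrite in_cons => /predU1P[->|rQ]; first by rewrite Order.POrderTheory.ltxx.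
by apply: contra (qmin r rQ) => rp; exact: Order.POrderTheory.lt_trans pq.
Qed.

(** A minimal member of [Q] is seen by no member of [Q], so it can be recoloured last without
    affecting their guesses. *)
Lemma losing_finite (K0 : set K) (Q : seq P) : K0 !=set0 ->
  (forall p h, ~ (K0 `<=` phi p h)) ->
  exists h : P -> K, (forall p, K0 (h p)) /\ forall p, p \in Q -> ~ phi p h (h p).
Proof.
move=> [k0 K0k0] phi_nK0; have [n] := ubnP (size Q).
elim: n Q => // n IH [|p Q] size_lt; first by exists (fun=> k0).
have [q [qQ qmin]] := exists_minimal p Q.
have [|h [hK0 hlose]] := IH [seq r <- p :: Q | r != q].
  rewrite -ltnS (leq_trans _ size_lt)// ltnS size_filter.
  rewrite -(count_predC (predC1 q) (p :: Q)) -addn1 leq_add2l -has_count.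
  by apply/hasP; exists q => //=; rewrite negbK.
have /existsNP[c /not_implyP[K0c cP]] := phi_nK0 q h.
pose h' r := if r == q then c else h r.
have hE r : ~~ (r < q)%O -> phi r h' = phi r h.
  move=> rq; have [D Dr DP] := phi_local r h; apply: DP => s /Dr rs.
  by rewrite /h'; case: eqP => // sq; rewrite -sq rs in rq.
exists h'; split=> [r|r rQ]; first by rewrite /h'; case: ifP.
rewrite hE ?qmin// /h'; case: eqP => [->//|/eqP rq].
by apply: hlose; rewrite mem_filter rq.
Qed.

(** Colourings in [K0] that lose on finitely many points generate a filter on a compact space. A
    cluster point loses everywhere, since whether [p] is right depends on finitely many colours. *)
Lemma losing_compact (K0 : set K) : K0 !=set0 -> finite_set K0 ->
  (forall p h, ~ (K0 `<=` phi p h)) ->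
  exists h : P -> K, forall p, ~ phi p h (h p).
Proof.
move=> K00 K0fin phi_nK0.
pose T : topologicalType := {ptws P -> discr K}.
pose C : set T := [set h | forall p, K0 (h p)].
have C_compact : compact C.
  apply: (@tychonoff P (fun=> discr K) (fun=> K0)) => _; exact: finite_compact.
pose F : set_system T := [set A | exists Q : seq P,
  forall h : P -> K, C h -> (forall p, p \in Q -> ~ phi p h (h p)) -> A h].
have F_proper : ProperFilter F.
  split.
    move=> [Q QF]; have [h [hC hQ]] := losing_finite Q K00 phi_nK0.
    exact: (QF h hC hQ).
  split.
  - by exists [::].
  - move=> A B [Q QA] [R RB]; exists (Q ++ R) => h hC hQR; split.
      by apply: QA => // p pQ; apply: hQR; rewrite mem_cat pQ.
    by apply: RB => // p pR; apply: hQR; rewrite mem_cat pR orbT.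
  - by move=> A B AB [Q QA]; exists Q => h hC /(QA h hC)/AB.
have [|h [_ hF]] := C_compact F F_proper; first by exists [::].
exists h => p; have [D _ DP] := phi_local p h.
have [||h' [h'p h'D]] := hF [set h' : T | ~ phi p (h' : P -> K) ((h' : P -> K) p)]
    [set h' : T | forall q, q \in p :: D -> (h' : P -> K) q = h q].
- by exists [:: p] => h' _; apply; exact: mem_head.
- apply/nbhs_ptws_discrete; exists (p :: D) => h' hh' q qD; apply: hh'.
  exact: ((mem_classic q (p :: D)).1 qD).
move: h'p; rewrite /= h'D ?mem_head// DP// => q qD.
by apply: h'D; rewrite in_cons qD orbT.
Qed.

End Losing.

Lemma hat_game_lost {d : Order.disp_t} (P : porderType d) (K G : Type) :
  (forall phi : P -> (P -> K) -> set K,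
     local_guess (fun p q => (p < q)%O) phi ->
     (forall p h, phi p h #< [set: G]) ->
     exists h : P -> K, forall p, ~ phi p h (h p)) ->
  ~ hat_game_winning P K G.
Proof.
move=> lost [f [fc fwin]].
have [|p h|h hlose] := lost (fun p h => sval (f p (@restrict_above d P K h p))).
- move=> p h.
  have [D DP] := (continuous_discreteP (f p)).1 (fc p) (@restrict_above d P K h p).
  exists (map sval D) => [_ /mapP[q _ ->]|h' h'D]; first exact: svalP q.
  by congr sval; apply: DP => q qD; apply: h'D; apply: map_f; exact/mem_classic.
- exact: svalP (f p _).
by have [p] := fwin h; exact: hlose.
Qed.

(** This confines the colours to [M]: a losing [h] for the guesses pulled back along [i] yields the
    losing colouring [i \o h]. *)
Lemma local_guess_comp (P : eqType) (S : P -> set P) (K M : Type) (i : M -> K)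
    (phi : P -> (P -> K) -> set K) :
  local_guess S phi -> local_guess S (fun p h => i @^-1` phi p (i \o h)).
Proof.
move=> phi_loc p h; have [D Dp DP] := phi_loc p (i \o h).
by exists D => // h' h'D; rewrite (DP (i \o h'))// => q qD /=; rewrite h'D.
Qed.

Theorem theoremB (d : Order.disp_t) (P : porderType d) (K G : Type)
    (P0 : [set: P] !=set0) (K1 : `I_1 #<= [set: K]) (G2 : `I_2 #<= [set: G]) :
  hat_game_winning P K G <->
  ([set: K] #< [set: G] \/
   [/\ exists s : nat -> P, (forall m n : nat, (m < n)%N -> (s m < s n)%O),
       infinite_set [set: G] &
       ~ exists M : Type, [/\ [set: G] #< [set: M], [set: M] #<= [set: K] &
                             strongly_MInA M]]).
Proof.
split=> [win|[KG|[[s s_lt] Ginf noM]]]; last first.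
- exact: uniform_win_hat_game s_lt (uniform_win_no_MInA Ginf noM).
- exact: card_lt_hat_game.
have [KG|nKG] := pselect ([set: K] #< [set: G]); [by left|right].
have GK : [set: G] #<= [set: K].
  by apply: contrapT => nGK; apply: nKG; exact: card_leNgt.
have nonempty n (T : Type) : `I_n.+1 #<= [set: T] -> [set: T] !=set0.
  move=> nT; apply/set0P/negP => /eqP T0; move: nT; rewrite T0 card_le0 => /eqP In0.
  by have : `I_n.+1 0 by []; rewrite In0.
have K0 := nonempty _ _ K1.
have Ginf : infinite_set [set: G].
  (* For finite [G], colours are taken in a copy [range i] of [G], which no guess of size less than
     [G] contains. *)
  move=> Gfin; have [i iI] : embeds G K by exact/embedsP.
  apply: hat_game_lost win => phi phi_loc phi_small.
  apply: (losing_compact phi_loc (K0 := range i)).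
  - by have [g _] := nonempty _ _ G2; exists (i g); exists g.
  - exact: finite_image.
  move=> p h /subset_card_le ilephi; apply: (card_ltNge (phi_small p h)).
  apply: card_le_trans ilephi; have : range i #= [set: G].
    by apply: inj_card_eq => x y _ _; exact: iI.
  by rewrite card_eq_le => /andP[].
split=> //.
- apply: contrapT => no_seq; apply: hat_game_lost win => phi phi_loc phi_small.
  apply: losing_noetherian => // p h phiT; apply: (card_ltNge (phi_small p h)).
  exact: card_le_trans GK (subset_card_le phiT).
- move=> [M [GM MK [_ /(_ G Ginf GM) MG]]].
  have [i iI] : embeds M K by exact/embedsP.
  apply: hat_game_lost win => phi phi_loc phi_small.
  have [|h hlose] := losing_MInA (local_guess_comp i phi_loc) _ MG.
    by move=> p h; apply: card_le_lt_trans (phi_small p _); exact: preimage_card_le.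
  by exists (i \o h).
Qed.
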